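(* Let $R$ be a quasi-fiber product ring with respect to the regular sequence $\underline x=x_1,\ldots,x_n$. Let $M$ and $N$ be nonzero finitely generated $R$-modules. If $N$ is a Tor-rigid maximal Cohen-Macaulay module and, for some integer $t>n$, $\operatorname{Ext}^i_R(M,N)=0$ whenever $t\le i\le t+n$, then $\operatorname{pd}_R M<\infty$ or $N$ is free.
   Context: All local rings are commutative and Noetherian, and all modules are finitely generated; $\operatorname{pd}$ denotes projective dimension. A local ring $(R,\mathfrak m,k)$ is a fiber product ring if $R\cong S\times_k T=\{(s,t)\in S\times T : \pi_S(s)=\pi_T(t)\}$, where $S,T$ are local rings with the same residue field $k$, neither of them equal to $k$, and $\pi_S,\pi_T$ are the reductions modulo the maximal ideals. Equivalently, $\mathfrak m=I\oplus J$ for nonzero ideals $I,J$ of $R$. A local ring $R$ is a quasi-fiber product ring with respect to $\underline x=x_1,\dots,x_n$ ($n\ge 0$) if $\underline x$ is an $R$-regular sequence such that $R/(\underline x)$ is a fiber product ring. An $R$-module $N$ is Tor-rigid if for every $R$-module $Z$ and every $j\ge 1$, $\operatorname{Tor}^R_j(N,Z)=0$ implies $\operatorname{Tor}^R_{j+1}(N,Z)=0$. A nonzero module $N$ is maximal Cohen-Macaulay if $\operatorname{depth}_R N=\dim R$. *)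

(* Defs.v *)
From HB Require Import structures.
From mathcomp Require Import all_boot all_algebra.
From mathcomp Require Import ring_quotient sesquilinear.

Set Implicit Arguments.
Unset Strict Implicit.
Unset Printing Implicit Defensive.

Import GRing.Theory.
Local Open Scope ring_scope.

Section LocalRings.
Variable R : comNzRingType.

(* v \in (s_1, ..., s_n) V.  For V = R^o this is membership in the ideal
   generated by s. *)
Definition in_smul (V : lmodType R) (s : seq R) (v : V) : Prop :=
  exists c : 'I_(size s) -> V, v = \sum_(i < size s) s`_i *: c i.

(* An idealr is proper by definition; the unit ideal is generated by 1 anyway. *)
Definition noetherian : Prop :=
  forall I : idealr R, exists s : seq R,
    forall a : R, a \in I <-> in_smul s (a : R^o).

Definition maximal_ideal (m : idealr R) : Prop :=
  forall I : idealr R, {subset m <= I} -> {subset I <= m}.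

Definition local_ring (m : idealr R) : Prop :=
  [/\ noetherian,
      maximal_ideal m &
      forall m' : idealr R, maximal_ideal m' -> m' =i m].

Definition prime_chain (d : nat) : Prop :=
  exists P : nat -> prime_idealr R, forall i, (i < d)%N ->
    {subset P i <= P i.+1} /\ ~ {subset P i.+1 <= P i}.

Definition has_krull_dim (d : nat) : Prop :=
  prime_chain d /\ forall e, prime_chain e -> (e <= d)%N.

Definition regular_seq (V : lmodType R) (s : seq R) : Prop :=
  (forall i, (i < size s)%N -> forall v : V,
     in_smul (take i s) (s`_i *: v) -> in_smul (take i s) v)
  /\ (exists v : V, ~ in_smul s v).

Definition has_depth (m : idealr R) (V : lmodType R) (d : nat) : Prop :=
  (exists s : seq R, [/\ size s = d, {subset s <= m} & regular_seq V s])
  /\ (forall s : seq R, {subset s <= m} -> regular_seq V s -> (size s <= d)%N).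

End LocalRings.

Section FiberProducts.

Definition residue_map (S : comNzRingType) (m : idealr S) (k : fieldType)
    (p : {rmorphism S -> k}) : Prop :=
  (forall y : k, exists s : S, p s = y) /\ (forall s : S, p s = 0 <-> s \in m).

(* The last two clauses say that f is an isomorphism of A onto the subring
   {(s, t) | p s = q t} of S * T; S and T differ from k because their maximal
   ideals are nonzero. *)
Definition fiber_product_ring (A : comNzRingType) : Prop :=
  exists (S T : comNzRingType) (mS : idealr S) (mT : idealr T) (k : fieldType)
         (p : {rmorphism S -> k}) (q : {rmorphism T -> k})
         (f : {rmorphism A -> S * T}),
    [/\ local_ring mS /\ local_ring mT,
        residue_map mS p /\ residue_map mT q,
        (exists2 s : S, s \in mS & s != 0) /\ (exists2 t : T, t \in mT & t != 0),
        injective f &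
        forall st : S * T, p st.1 = q st.2 <-> exists a : A, f a = st].

Definition quasi_fiber_product_ring (R : comNzRingType) (x : seq R) : Prop :=
  regular_seq (R^o : lmodType R) x /\
  exists2 I : idealr R,
    (forall a : R, a \in I <-> in_smul x (a : R^o)) &
    fiber_product_ring {ideal_quot I}.

End FiberProducts.

Section Modules.
Variable R : comNzRingType.

Definition nonzero_module (V : lmodType R) : Prop := exists v : V, v != 0.

Definition fin_gen (V : lmodType R) : Prop :=
  exists (n : nat) (g : 'I_n -> V), forall v : V,
    exists c : 'I_n -> R, v = \sum_(i < n) c i *: g i.

(* Freeness for finitely generated modules: V is isomorphic to some R^r. *)
Definition free_module (V : lmodType R) : Prop :=
  exists (r : nat) (f : {linear 'rV[R]_r -> V}), bijective f.

Definition projective (P : lmodType R) : Prop :=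
  forall (A B : lmodType R) (g : {linear A -> B}) (f : {linear P -> B}),
    (forall y : B, exists x : A, g x = y) ->
    exists h : {linear P -> A}, forall x : P, g (h x) = f x.

(* ... -> res_mod 1 -> res_mod 0 -> V -> 0 *)
Record proj_resolution (V : lmodType R) := ProjResolution {
  res_mod : nat -> lmodType R;
  res_diff : forall i, {linear res_mod i.+1 -> res_mod i};
  res_aug : {linear res_mod 0 -> V};
  res_projective : forall i, projective (res_mod i);
  res_aug_surj : forall v : V, exists p, res_aug p = v;
  res_exact0 : forall p : res_mod 0,
    res_aug p = 0 <-> exists q, res_diff 0 q = p;
  res_exactS : forall i (p : res_mod i.+1),
    res_diff i p = 0 <-> exists q, res_diff i.+1 q = p
}.

Definition finite_pd (V : lmodType R) : Prop :=
  exists (P : proj_resolution V) (n : nat),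
    forall i, (n < i)%N -> forall p : res_mod P i, p = 0.

(* Ext^i(V, W) = H^i(Hom(P, W)) for a projective resolution P of V; up to
   isomorphism it does not depend on P, so it is enough that it vanishes for
   some P.  The same remark applies to Tor below. *)
Definition Ext_zero (i : nat) (V W : lmodType R) : Prop :=
  exists P : proj_resolution V,
  forall f : {linear res_mod P i -> W},
    (forall p, f (res_diff P i p) = 0) ->
    match i return {linear res_mod P i -> W} -> Prop with
    | 0 => fun f => forall p, f p = 0
    | j.+1 => fun f =>
        exists g : {linear res_mod P j -> W}, forall p, f p = g (res_diff P j p)
    end f.

(* (T, b) is the tensor product of V and W over R. *)
Definition is_tensor (V W T : lmodType R) (b : {bilinear V -> W -> T}) : Prop :=
  forall (U : lmodType R) (c : {bilinear V -> W -> U}),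
    (exists h : {linear T -> U}, forall v w, h (b v w) = c v w) /\
    (forall h h' : {linear T -> U},
       (forall v w, h (b v w) = h' (b v w)) -> h =1 h').

(* T i is the tensor product of P_i and W, and D is the differential of P
   tensored with W, so that the last clause is H_j(T) = 0. *)
Definition Tor_zero (j : nat) (V W : lmodType R) : Prop :=
  exists (P : proj_resolution V) (T : nat -> lmodType R)
         (b : forall i, {bilinear res_mod P i -> W -> T i})
         (D : forall i, {linear T i.+1 -> T i}),
    [/\ forall i, is_tensor (b i),
        forall i p w, D i (b i.+1 p w) = b i (res_diff P i p) w &
        forall t : T j,
          match j return T j -> Prop with
          | 0 => fun=> True
          | l.+1 => fun t => D l t = 0
          end t ->
          exists u : T j.+1, D j u = t].

Definition Tor_rigid (V : lmodType R) : Prop :=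
  forall Z : lmodType R, fin_gen Z ->
  forall j, (1 <= j)%N -> Tor_zero j V Z -> Tor_zero j.+1 V Z.

Definition maximal_CM (m : idealr R) (V : lmodType R) : Prop :=
  nonzero_module V /\ exists d, has_depth m V d /\ has_krull_dim R d.

End Modules.

(* Main.v *)
Require Import Defs.
From HB Require Import structures.
From mathcomp Require Import all_boot all_algebra.
From mathcomp Require Import ring_quotient sesquilinear.
From mathcomp Require Import boolp.
From mathcomp Require Import ring zify.

Set Implicit Arguments.
Unset Strict Implicit.
Unset Printing Implicit Defensive.

Import GRing.Theory.
Local Open Scope ring_scope.

(** Let F and G be minimal free resolutions of M and N, and let E_t be the
    cokernel of the transpose of the differential F_(t+1) -> F_t.

    The vanishing of Ext^t(M, N) gives Tor_1(E_t, N) = 0 (ext_tor1), hence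
    Tor_j(E_t, N) = 0 for all j > 0 by rigidity; the vanishing of Tor_2 and
    Nakayama's lemma then give Ext^t(M, R) = 0 (ext_exact).  As this happens in
    n + 1 consecutive degrees, E_t is an n-th syzygy, so that the sequence x is
    regular on E_t (dual_inj, dual_wreg), and Tor_j(E_t / x E_t, N) = 0 for
    j > n (tor_van_quo).

    Now m / (x) is the direct sum of I / (x) and J / (x), where I and J are
    nonzero modulo (x) (fiber_product_ideals).  Let Y be the second syzygy over
    R / (x) of E_t / x E_t.  Minimality puts Y inside m times a free module, so
    Y is the sum of a part killed by J and a part killed by I.  If U is a
    nonzero module killed by J, then J / (x) is a direct summand in a syzygy of
    U (tor_van_residual_summand); applied first to a part of Y and then to
    J / (x) itself, and with I and J exchanged where needed, this shows that
    Tor_j(m / (x), N), and so Tor_j(k, N), vanishes for large j: G is bounded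
    (decomposable_bounded).  If Y = 0, then Nakayama's lemma makes a
    differential of F vanish and pd M is finite (rigid_dichotomy).

    Finally, suppose that G is bounded and N is not free.  Factoring out of N a
    regular sequence of length dim R yields a module of finite projective
    dimension greater than dim R (res_length_quo).  But projective dimensions,
    when finite, are bounded by the length of a maximal R-regular sequence,
    because such a sequence z leaves a socle in R / (z), and this length is at
    most dim R (res_length_dim). *)

(** * Submodules and Noetherian rings *)

Section Submodules.
Variable R : comNzRingType.

(** Submodules are given by arbitrary propositions, so that subquotients can be
    handled as pairs of submodules of a fixed module. *)
Record submod (V : lmodType R) := Submod {
  smem :> V -> Prop;
  smem0 : smem 0;
  smemP : forall a u v, smem u -> smem v -> smem (a *: u + v) }.

Section Closure.
Variables (V : lmodType R) (P : submod V).

Lemma smemD u v : P u -> P v -> P (u + v).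
Proof. by move=> Pu Pv; rewrite -[u]scale1r; apply: smemP. Qed.

Lemma smemZ a u : P u -> P (a *: u).
Proof. by move=> Pu; rewrite -[_ *: _]addr0; apply: smemP => //; apply: smem0. Qed.

Lemma smemN u : P u -> P (- u).
Proof. by move=> Pu; rewrite -scaleN1r; apply: smemZ. Qed.

Lemma smemB u v : P u -> P v -> P (u - v).
Proof. by move=> Pu Pv; apply: smemD => //; apply: smemN. Qed.

Lemma smem_sum I (r : seq I) (p : pred I) (F : I -> V) :
  (forall i, p i -> P (F i)) -> P (\sum_(i <- r | p i) F i).
Proof. by move=> PF; apply: big_ind => //; [apply: smem0 | apply: smemD]. Qed.

Lemma smem_sub u v : P (u - v) -> P v -> P u.
Proof. by move=> Puv Pv; rewrite -(subrK v u); apply: smemD. Qed.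

End Closure.

Definition zero_sub (V : lmodType R) : submod V.
Proof.
by exists (fun v => v = 0) => // a u v -> ->; rewrite scaler0 addr0.
Defined.

Definition full_sub (V : lmodType R) : submod V.
Proof. by exists (fun=> True). Defined.

Definition cap_sub (V : lmodType R) (P Q : submod V) : submod V.
Proof.
exists (fun v => P v /\ Q v); first by split; apply: smem0.
by move=> a u v [Pu Qu] [Pv Qv]; split; apply: smemP.
Defined.

Definition sum_sub (V : lmodType R) (P Q : submod V) : submod V.
Proof.
exists (fun v => exists2 u, P u & Q (v - u)).
  by exists 0; rewrite ?subr0; apply: smem0.
move=> a u v [u1 Pu Qu] [v1 Pv Qv]; exists (a *: u1 + v1); first exact: smemP.
by rewrite opprD addrACA -scalerBr; apply: smemP.
Defined.

Definition im_sub (V W : lmodType R) (f : {linear V -> W}) : submod W.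
Proof.
exists (fun w => exists v, w = f v); first by exists 0; rewrite linear0.
by move=> a _ _ [u ->] [v ->]; exists (a *: u + v); rewrite linearP.
Defined.

Definition preim_sub (V W : lmodType R) (f : {linear V -> W}) (P : submod W) :
  submod V.
Proof.
exists (fun v => P (f v)); first by rewrite linear0; apply: smem0.
by move=> a u v Pu Pv; rewrite linearP; apply: smemP.
Defined.

(** The submodule (s_1, ..., s_n) V. *)
Definition smul_sub (V : lmodType R) (s : seq R) : submod V.
Proof.
exists (in_smul s); first by exists (fun=> 0); rewrite big1 // => i _; rewrite scaler0.
move=> a _ _ [c ->] [c' ->]; exists (fun i => a *: c i + c' i).
rewrite scaler_sumr -big_split; apply: eq_bigr => i _.
by rewrite scalerDr !scalerA mulrC.
Defined.

(** Q + R g. *)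
Definition adjoin (V : lmodType R) (Q : submod V) (g : V) : submod V.
Proof.
exists (fun v => exists a : R, Q (v - a *: g)).
  by exists 0; rewrite scale0r subr0; apply: smem0.
move=> a u v [b Qu] [c Qv]; exists (a * b + c).
by rewrite scalerDl opprD addrACA -scalerA -scalerBr; apply: smemP.
Defined.

(** The submodule generated by Q and the elements of s. *)
Definition span (V : lmodType R) (Q : submod V) (s : seq V) : submod V :=
  foldr (fun g P => adjoin P g) Q s.

Lemma span_base (V : lmodType R) (Q : submod V) s v : Q v -> span Q s v.
Proof.
by elim: s v => //= g s IH v Qv; exists 0; rewrite scale0r subr0; apply: IH.
Qed.

Lemma span_gen (V : lmodType R) (Q : submod V) s (v : V) : v \in s -> span Q s v.
Proof.
elim: s => //= g s IH; rewrite inE => /orP[/eqP ->|/IH sv].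
  by exists 1; rewrite scale1r subrr; apply: smem0.
by exists 0; rewrite scale0r subr0.
Qed.

Lemma span_sub (V : lmodType R) (Q P : submod V) s :
  (forall v, Q v -> P v) -> (forall v, v \in s -> P v) ->
  forall v, span Q s v -> P v.
Proof.
move=> QP; elim: s => //= g s IH sP v [a /IH Pv].
apply: smem_sub (smemZ a (sP g _)); last by rewrite inE eqxx.
by apply: Pv => w ws; apply: sP; rewrite inE ws orbT.
Qed.

Lemma span_cat (V : lmodType R) (Q : submod V) s1 s2 (v : V) :
  span Q (s1 ++ s2) v <-> span (span Q s2) s1 v.
Proof. by rewrite /span foldr_cat. Qed.

Lemma spanE (V : lmodType R) (Q : submod V) s (v : V) :
  span Q s v <->
  exists c : 'I_(size s) -> R, Q (v - \sum_(i < size s) c i *: s`_i).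
Proof.
elim: s v => [|g s IH] v /=.
  split=> [Qv|[c]]; last by rewrite big_ord0 subr0.
  by exists (fun=> 0); rewrite big_ord0 subr0.
split=> [[a /IH [c Qc]]|[c]].
  exists (fun i => if unlift ord0 i is Some j then c j else a).
  rewrite big_ord_recl unlift_none opprD addrA /=.
  by under eq_bigr do rewrite liftK.
rewrite big_ord_recl opprD addrA => Qc; exists (c ord0).
by apply/IH; exists (fun j => c (lift ord0 j)).
Qed.

Lemma in_smulE (V : lmodType R) (s : seq R) (v : V) :
  in_smul s v <-> exists c : nat -> V, v = \sum_(i < size s) s`_i *: c i.
Proof.
split=> [[c ->]|[c ->]]; last by exists c.
exists (fun i => if insub i is Some j then c j else 0).
by apply: eq_bigr => i _; rewrite valK.
Qed.

Lemma smul_rcons (V : lmodType R) (s : seq R) a (v : V) :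
  smul_sub V (rcons s a) v <-> exists w, smul_sub V s (v - a *: w).
Proof.
rewrite /= in_smulE; split=> [[c ->]|[w /in_smulE[c e]]].
  exists (c (size s)); apply/in_smulE; exists c.
  rewrite size_rcons big_ord_recr /= nth_rcons ltnn eqxx addrK.
  by apply: eq_bigr => i _; rewrite nth_rcons ltn_ord.
exists (fun i => if i == size s then w else c i).
rewrite size_rcons big_ord_recr /= nth_rcons ltnn eqxx.
rewrite -[LHS](subrK (a *: w)) e; congr (_ + _); apply: eq_bigr => i _.
by rewrite nth_rcons ltn_ord ltn_eqF.
Qed.

Lemma smul_nil (V : lmodType R) (v : V) : smul_sub V [::] v <-> v = 0.
Proof.
split=> [[c ->]|->]; first by rewrite big_ord0.
exact: smem0.
Qed.

Lemma smul_linear (V W : lmodType R) (f : {linear V -> W}) (s : seq R) v :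
  smul_sub V s v -> smul_sub W s (f v).
Proof.
case=> c ->; exists (fun i => f (c i)); rewrite linear_sum.
by apply: eq_bigr => i _; rewrite linearZ.
Qed.

Lemma smul_gen (V : lmodType R) (s : seq R) a (v : V) :
  a \in s -> smul_sub V s (a *: v).
Proof.
move=> /(nthP 0)[i ilt <-]; exists (fun j => if val j == i then v else 0).
rewrite (bigD1 (Ordinal ilt)) //= eqxx big1 ?addr0 // => j.
by rewrite -val_eqE /= => /negbTE ->; rewrite scaler0.
Qed.

(** ** Noetherian rings *)

(** The coefficients a such that a *: g lies in P up to an element of S. *)
Definition lead_sub (V : lmodType R) (P S : submod V) (g : V) : submod R^o.
Proof.
exists (fun a => exists2 v, P v & S (v - a *: g)).
  by exists 0; [exact: smem0 | rewrite scale0r subr0; apply: smem0].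
move=> a b c [u Pu su] [v Pv sv]; exists (a *: u + v); first exact: smemP.
by rewrite scalerDl opprD addrACA -scalerA -scalerBr; apply: smemP.
Defined.

Lemma chain_mono (I : nat -> submod R^o) : (forall n a, I n a -> I n.+1 a) ->
  forall n k a, (n <= k)%N -> I n a -> I k a.
Proof.
move=> IS n k a /subnKC <-; elim: (k - n)%N => [|l IH] Ia; rewrite ?addn0 //.
by rewrite addnS; apply/IS/IH.
Qed.

Definition union_sub (I : nat -> submod R^o) (IS : forall n a, I n a -> I n.+1 a) :
  submod R^o.
Proof.
exists (fun a => exists n, I n a); first by exists 0%N; apply: smem0.
move=> a u v [n In] [k Ik]; exists (maxn n k).
apply: smemP; first by apply: chain_mono In => //; apply: leq_maxl.
by apply: chain_mono Ik => //; apply: leq_maxr.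
Defined.

(** A proper ideal given by a proposition, as a decidable one. *)
Lemma pack_ideal (I : submod R^o) : ~ I (1 : R) ->
  exists J : idealr R, forall a, a \in J <-> I a.
Proof.
move=> I1; pose S : R -> bool := fun a => `[< I a >].
have SP : idealr_closed S.
  split; first by apply/asboolP; apply: (smem0 I).
    by apply/asboolPn.
  by move=> a u v /asboolP Iu /asboolP Iv; apply/asboolP; apply: (smemP a Iu Iv).
pose J : idealr R := HB.pack S (isIdealr.Build R S SP).
by exists J => a; split=> [/asboolP|/asboolP].
Qed.

Hypothesis noeth : noetherian R.

Lemma ideal_fg (I : submod R^o) :
  exists s : seq R^o, forall a, I a <-> span (zero_sub _) s a.
Proof.
have [I1|I1] := pselect (I (1 : R)).
  exists [:: (1 : R)] => a; split=> _; last by rewrite -[a]mulr1; apply: (smemZ a I1).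
  by exists a; rewrite /= [_ *: _]mulr1 subrr.
have [J JP] := pack_ideal I1.
have [s sP] := noeth J; exists s => a.
rewrite -JP sP spanE; split=> [[c ->]|[c /eqP]].
  by exists c; rewrite /= -sumrB big1 // => i _; apply/eqP; rewrite subr_eq0; apply/eqP/mulrC.
rewrite subr_eq0 => /eqP ->; exists c; apply: eq_bigr => i _; exact: mulrC.
Qed.

(** Every submodule of a finitely generated module is finitely generated; all
    modules are taken modulo a common submodule Q. *)
Lemma sub_fg (V : lmodType R) (Q : submod V) (s : seq V) (P : submod V) :
  (forall v, Q v -> P v) -> (forall v, P v -> span Q s v) ->
  exists s', forall v, P v <-> span Q s' v.
Proof.
elim: s P => [|g s IH] P QP Ps; first by exists [::] => v; split=> [/Ps|/QP].
pose I := lead_sub P (span Q s) g.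
have [as_ asP] := ideal_fg I.
have [||s' s'P] := IH (cap_sub P (span Q s)).
- by move=> v Qv; split; [apply: QP | apply: span_base].
- by move=> v [].
have [vs vsP lift] : exists2 vs : seq V, (forall v, v \in vs -> P v) &
    forall a, span (zero_sub _) as_ a ->
      exists2 w, span (zero_sub V) vs w & span Q s (w - a *: g).
  have: forall a, a \in as_ -> I a by move=> a aas; apply/asP; apply: span_gen.
  elim: (as_) => [|b r IHr] Ir.
    exists [::] => // a /= ->; exists 0 => //.
    by rewrite scale0r subrr; apply: smem0.
  have [|vs vsP lift] := IHr; first by move=> a ar; apply: Ir; rewrite inE ar orbT.
  have [v Pv sv] : I b by apply: Ir; rewrite inE eqxx.
  exists (v :: vs); first by move=> u; rewrite inE => /orP[/eqP ->//|/vsP].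
  move=> a [c /lift[w ws wg]]; exists (w + c *: v).
    by exists c; rewrite addrK.
  have -> : w + c *: v - a *: g = (w - (a - c *: b) *: g) + c *: (v - b *: g).
    rewrite scalerBr scalerBl scalerA opprB [_ *: (b : R^o)]/GRing.scale /=.
    by rewrite [in RHS]addrACA; congr (_ + _); rewrite addrAC subrr add0r.
  by apply: smemD => //; apply: smemZ.
exists (vs ++ s') => v; rewrite span_cat; split=> [Pv|].
  have [a sv] := Ps v Pv.
  have [|w ws wg] := lift a; first by apply/asP; exists v.
  have Pw : P w by apply: span_sub ws => // _ ->; apply: smem0.
  rewrite -(subrK w v); apply: smemD.
    apply/span_base/s'P; split; first exact: smemB.
    have -> : v - w = (v - a *: g) - (w - a *: g) by rewrite opprB addrA subrK.
    exact: smemB.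
  by apply: span_sub ws; [move=> _ ->; apply: smem0 | move=> u; apply: span_gen].
by apply: span_sub => // u /s'P [].
Qed.

Lemma ideal_acc (I : nat -> submod R^o) :
  (forall n a, I n a -> I n.+1 a) ->
  exists n, forall k a, I k a -> I n a.
Proof.
move=> IS.
have Imono := chain_mono IS.
pose U := union_sub IS.
have [s sP] := ideal_fg U.
have sI : forall a, a \in s -> U a by move=> a ain; apply/sP; apply: span_gen.
have [n nP] : exists n, forall a, a \in s -> I n a.
  elim: s sI {sP} => [|g s IH] sI; first by exists 0%N.
  have [|n nP] := IH; first by move=> a ain; apply: sI; rewrite inE ain orbT.
  have [k kP] : U g by apply: sI; rewrite inE eqxx.
  exists (maxn n k) => a; rewrite inE => /orP[/eqP ->|/nP].
    by apply: Imono kP; apply: leq_maxr.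
  by apply: Imono; apply: leq_maxl.
exists n => k a Ika; have /sP : U a by exists k.
by apply: span_sub => // _ ->; apply: smem0.
Qed.

Lemma noeth_ind (Phi : submod R^o -> Prop) :
  (forall I : submod R^o,
    (forall J : submod R^o, (forall a, I a -> J a) -> (exists2 a, J a & ~ I a) ->
       Phi J) -> Phi I) ->
  forall I, Phi I.
Proof.
move=> step I0; apply: contrapT => nI0.
pose T := {I : submod R^o | ~ Phi I}.
have next (I : T) : {J : T | (forall a, sval I a -> sval J a) /\
                             exists2 a, sval J a & ~ sval I a}.
  apply: cid; apply: contrapT => no; apply: (svalP I); apply: step => J IJ JI.
  by apply: contrapT => nJ; apply: no; exists (exist _ J nJ).
pose f n : T := iter n (fun I => sval (next I)) (exist _ I0 nI0).
have [n nP] := @ideal_acc (fun n => sval (f n)) (fun n => (svalP (next (f n))).1).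
by have [a Ia nIa] := (svalP (next (f n))).2; apply: nIa; apply: (nP n.+1).
Qed.

(** An ideal with a property is contained in one that is maximal for it. *)
Lemma noeth_max (Phi : submod R^o -> Prop) (I : submod R^o) : Phi I ->
  exists2 J : submod R^o, Phi J /\ (forall a, I a -> J a) &
    forall K : submod R^o, Phi K -> (forall a, J a -> K a) -> forall a, K a -> J a.
Proof.
elim/noeth_ind: I => I IH PI.
have [[K [PK IK [a Ka nIa]]]|no] := pselect (exists K : submod R^o,
    [/\ Phi K, (forall a, I a -> K a) & exists2 a, K a & ~ I a]).
  have [|J [PJ KJ] Jmax] := IH K IK _ PK; first by exists a.
  by exists J => //; split=> // b /IK /KJ.
exists I => // K PK IK a Ka; apply: contrapT => nIa; apply: no.
by exists K; split=> //; exists a.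
Qed.

End Submodules.
(** * Minimal generators over a local ring *)

Section LocalRing.
Variables (R : comNzRingType) (m : idealr R).
Hypothesis Rloc : local_ring m.

Lemma local_noeth : noetherian R. Proof. by case: Rloc. Qed.

Definition ideal_sub (I : idealr R) : submod R^o.
Proof.
exists (fun a : R => is_true (a \in I)); first exact: (idealr0 I).
by move=> a u v uI vI; apply: (@rpredD _ I) => //; apply: (idealMr a uI).
Defined.

Lemma max1 : (1 : R) \notin m. Proof. by rewrite idealr1. Qed.

Lemma unit_notin a : a \notin m -> exists b, b * a = 1.
Proof.
move=> am; apply: contrapT => nb.
have I1 : ~ span (zero_sub R^o) [:: (a : R^o)] (1 : R).
  case=> b /eqP; rewrite subr_eq0 => /eqP e; apply: nb; exists b.
  exact: esym e.
have [J [J1 IJ] Jmax] :=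
  noeth_max local_noeth (Phi := fun J : submod R^o => ~ J (1 : R)) I1.
have [K KP] := pack_ideal J1.
have mK : maximal_ideal K.
  move=> L KL b bL; apply/KP; apply: (Jmax (ideal_sub L)) => //.
    by rewrite /= idealr1.
  by move=> c /KP /KL.
have [_ _ /(_ _ mK) Km] := Rloc.
by case/negP: am; rewrite -Km; apply/KP/IJ; apply: span_gen; rewrite inE eqxx.
Qed.

(** A finitely generated P has generators modulo Q whose relations modulo Q all
    have coefficients in m. *)
Lemma min_gens (V : lmodType R) (Q P : submod V) s :
  (forall v, P v <-> span Q s v) ->
  exists (n : nat) (u : 'I_n -> V), [/\ forall k, P (u k),
    forall v, P v -> exists c : 'I_n -> R, Q (v - \sum_k c k *: u k) &
    forall c : 'I_n -> R, Q (\sum_k c k *: u k) -> forall k, c k \in m].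
Proof.
move=> PE.
pose gen n := exists u : 'I_n -> V, (forall k, P (u k)) /\
  forall v, P v -> exists c : 'I_n -> R, Q (v - \sum_k c k *: u k).
have ex : exists n, `[< gen n >].
  exists (size s); apply/asboolP; exists (fun k => s`_k); split=> [k|v /PE/spanE//].
  by apply/PE/span_gen/mem_nth.
case: (ex_minnP ex) => n /asboolP[u [Pu uP]] nmin; exists n, u; split=> // c Qc k.
case: n => [|n] in u Pu uP nmin c Qc k *; first by case: k.
apply: contrapT => /negP /unit_notin [b bc].
suff /asboolP /nmin : gen n by rewrite ltnn.
exists (fun j => u (lift k j)); split=> // v /uP[e Qe].
exists (fun j => e (lift k j) - e k * b * c (lift k j)).
move: Qe Qc; rewrite (bigD1_ord k) // [in X in _ -> X](bigD1_ord k) //= => Qe Qc.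
move/(smemZ (e k * b)): Qc; rewrite scalerDr scalerA -mulrA bc mulr1 scaler_sumr.
have -> : \sum_(i < n) (e (lift k i) - e k * b * c (lift k i)) *: u (lift k i) =
   \sum_(i < n) e (lift k i) *: u (lift k i)
   - \sum_(i < n) (e k * b) *: (c (lift k i) *: u (lift k i)).
  by rewrite -sumrB; apply: eq_bigr => i _; rewrite scalerBl scalerA.
move/(smemD Qe); congr (smem Q _).
by rewrite [e k *: _ + \sum_(i < n) e _ *: _]addrC opprB opprD !addrA subrK addrAC.
Qed.

(** If P is finitely generated modulo Q and contained in Q + m P, then P is
    contained in Q. *)
Lemma nakayama (V : lmodType R) (Q P : submod V) s :
  (forall v, P v <-> span Q s v) ->
  (forall v, P v -> exists n (a : 'I_n -> R) (p : 'I_n -> V),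
    [/\ forall i, a i \in m, forall i, P (p i) & Q (v - \sum_i a i *: p i)]) ->
  forall v, P v -> Q v.
Proof.
move=> PE PmP; have [[|n] [u [Pu uP urel]]] := min_gens PE.
  by move=> v /uP[c]; rewrite big_ord0 subr0.
have [l [a [p [am Pp Qp]]]] := PmP _ (Pu ord0).
have /choice[C CP] : forall i, exists c : 'I_n.+1 -> R, Q (p i - \sum_k c k *: u k).
  by move=> i; apply: uP.
have /urel/(_ ord0) : Q (\sum_k ((k == ord0)%:R - \sum_i a i * C i k) *: u k).
  have -> : \sum_k ((k == ord0)%:R - \sum_i a i * C i k) *: u k =
    u ord0 - \sum_i a i *: p i + \sum_i a i *: (p i - \sum_k C i k *: u k).
    under eq_bigr do rewrite scalerBl scaler_suml.
    rewrite sumrB (bigD1 ord0) //= scale1r big1 ?addr0; last first.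
      by move=> k /negbTE ->; rewrite scale0r.
    under [X in _ = _ + X]eq_bigr do rewrite scalerBr scaler_sumr.
    rewrite sumrB addrA subrK exchange_big; congr (_ - _).
    by apply: eq_bigr => i _; apply: eq_bigr => k _; rewrite scalerA.
  by apply: smemD => //; apply: smem_sum => i _; apply: smemZ.
rewrite eqxx /= => h; case/negP: max1.
rewrite -(subrK (\sum_i a i * C i ord0) 1) rpredD // rpred_sum // => i _.
by rewrite mulrC idealMr.
Qed.

End LocalRing.
(** * Complexes of free modules and Tor *)

Section Complexes.
Variable R : comNzRingType.

(** The action of a matrix on a row of coefficients in a module: the map
    V^b -> V^c obtained from the matrix A by tensoring with V. *)
Definition vmul (V : lmodType R) b c (v : 'I_b -> V) (A : 'M[R]_(b, c)) (l : 'I_c) : V :=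
  \sum_k A k l *: v k.

Section Vmul.
Variable V : lmodType R.
Implicit Types (b c e : nat).

Lemma vmul_mul b c e (v : 'I_b -> V) (A : 'M[R]_(b, c)) (B : 'M[R]_(c, e)) l :
  vmul (vmul v A) B l = vmul v (A *m B) l.
Proof.
rewrite /vmul; under eq_bigr do rewrite scaler_sumr.
rewrite exchange_big; apply: eq_bigr => k _; rewrite mxE scaler_suml.
by apply: eq_bigr => i _; rewrite scalerA mulrC.
Qed.

Lemma vmul0 b c (v : 'I_b -> V) l : vmul v (0 : 'M[R]_(b, c)) l = 0.
Proof. by rewrite /vmul big1 // => k _; rewrite mxE scale0r. Qed.

Lemma vmulB b c (v w : 'I_b -> V) (A : 'M[R]_(b, c)) l :
  vmul (fun k => v k - w k) A l = vmul v A l - vmul w A l.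
Proof. by rewrite /vmul -sumrB; apply: eq_bigr => k _; rewrite scalerBr. Qed.

Lemma vmulD b c (v w : 'I_b -> V) (A : 'M[R]_(b, c)) l :
  vmul (fun k => v k + w k) A l = vmul v A l + vmul w A l.
Proof. by rewrite /vmul -big_split; apply: eq_bigr => k _; rewrite scalerDr. Qed.

Lemma vmulZ b c a (v : 'I_b -> V) (A : 'M[R]_(b, c)) l :
  vmul (fun k => a *: v k) A l = a *: vmul v A l.
Proof. by rewrite /vmul scaler_sumr; apply: eq_bigr => k _; rewrite !scalerA mulrC. Qed.

Lemma eq_vmul b c (v w : 'I_b -> V) (A : 'M[R]_(b, c)) l :
  v =1 w -> vmul v A l = vmul w A l.
Proof. by move=> vw; apply: eq_bigr => k _; rewrite vw. Qed.

Lemma smem_vmul (P : submod V) b c (v : 'I_b -> V) (A : 'M[R]_(b, c)) l :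
  (forall k, P (v k)) -> P (vmul v A l).
Proof. by move=> Pv; apply: smem_sum => k _; apply: smemZ. Qed.

End Vmul.

Lemma linear_vmul (V W : lmodType R) (f : {linear V -> W}) b c (v : 'I_b -> V)
    (A : 'M[R]_(b, c)) l : f (vmul v A l) = vmul (f \o v) A l.
Proof. by rewrite linear_sum; apply: eq_bigr => k _; rewrite linearZ. Qed.

Lemma vmul_row b c (v : 'I_b -> R^o) (A : 'M[R]_(b, c)) l :
  vmul v A l = ((\row_k v k) *m A) 0 l.
Proof. by rewrite !mxE; apply: eq_bigr => k _; rewrite mxE; apply: mulrC. Qed.

Section Tor.
Variables (b : nat -> nat) (d : forall i, 'M[R]_(b i.+1, b i)).

(** The vanishing of the homology in degree j + 1 of the complex d tensored
    with P / Q; for a resolution of N this is Tor_(j+1)(P / Q, N) = 0.  It is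
    meant for submodules Q of P; the shift by one leaves Tor_0 out. *)
Definition tor_van (V : lmodType R) (P Q : submod V) (j : nat) : Prop :=
  forall v : 'I_(b j.+1) -> V, (forall k, P (v k)) ->
    (forall l, Q (vmul v (d j) l)) ->
    exists2 w : 'I_(b j.+2) -> V, (forall k, P (w k)) &
      forall k, Q (v k - vmul w (d j.+1) k).

Hypothesis dd : forall i, d i.+1 *m d i = 0.

Lemma tor_van_ext (V : lmodType R) (P Q P' Q' : submod V) j :
  (forall v, P v <-> P' v) -> (forall v, Q v <-> Q' v) ->
  tor_van P Q j -> tor_van P' Q' j.
Proof.
move=> PP QQ T v Pv Qv.
have [k|l|w Pw Qw] := T v; [exact/PP | exact/QQ |].
by exists w => k; [apply/PP | apply/QQ].
Qed.

(** Tor of V / W and of the quotient W' = W + x V, for x regular on V / W: one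
    degree of vanishing is lost. *)
Lemma tor_van_mod (V : lmodType R) (W W' : submod V) (x : R) j :
  (forall u, W (x *: u) -> W u) ->
  (forall v, W' v <-> exists u, W (v - x *: u)) ->
  tor_van (full_sub V) W j -> tor_van (full_sub V) W j.+1 ->
  tor_van (full_sub V) W' j.+1.
Proof.
move=> xreg W'P Tj TSj v _ Wv.
have /choice[s sP] : forall l, exists u, W (vmul v (d j.+1) l - x *: u).
  by move=> l; apply/W'P.
have [//|l|w _ wP] := Tj s.
  apply: xreg; rewrite -vmulZ.
  have := smem_vmul (d j) l sP; rewrite vmulB vmul_mul dd vmul0 sub0r.
  by move/smemN; rewrite opprK.
have [//|l|z _ zP] := TSj (fun k => v k - x *: w k).
  rewrite vmulB vmulZ.
  have -> : vmul v (d j.+1) l - x *: vmul w (d j.+1) l =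
    vmul v (d j.+1) l - x *: s l + x *: (s l - vmul w (d j.+1) l).
    by rewrite scalerBr addrA subrK.
  by apply: smemD => //; apply: smemZ.
by exists z => // k; apply/W'P; exists (w k); rewrite addrAC.
Qed.

(** (s) V + W. *)
Definition quo_sub (V : lmodType R) (W : submod V) (s : seq R) : submod V :=
  sum_sub (smul_sub V s) W.

Lemma quo_sub_rcons (V : lmodType R) (W : submod V) (s : seq R) (x : R) v :
  quo_sub W (rcons s x) v <-> exists u, quo_sub W s (v - x *: u).
Proof.
split=> [[u /smul_rcons[w su] Wu]|[w [u su Wu]]].
  by exists w, (u - x *: w) => //; rewrite opprB addrA subrK.
exists (u + x *: w); last by rewrite opprD addrA addrAC.
by apply/smul_rcons; exists w; rewrite addrK.
Qed.

(** The sequence s is regular on V / W, except that V / W may be equal to its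
    product with (s). *)
Definition wreg (V : lmodType R) (W : submod V) (s : seq R) : Prop :=
  forall k, (k < size s)%N -> forall u : V,
    quo_sub W (take k s) (s`_k *: u) -> quo_sub W (take k s) u.

Lemma tor_van_quo (V : lmodType R) (W : submod V) (s : seq R) j0 :
  wreg W s ->
  (forall j, (j0 <= j)%N -> tor_van (full_sub V) W j) ->
  forall j, (j0 + size s <= j)%N -> tor_van (full_sub V) (quo_sub W s) j.
Proof.
move=> sreg T j.
suff H k : (k <= size s)%N -> forall j, (j0 + k <= j)%N ->
    tor_van (full_sub V) (quo_sub W (take k s)) j.
  by move=> /H; rewrite take_size; apply.
elim: k => [|k IH] ks {}j; rewrite ?addn0.
  move=> /T; apply: tor_van_ext => // v; rewrite take0; split=> [Wv|].
    by exists 0; [exact/smul_nil | rewrite subr0].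
  by case=> u /smul_nil ->; rewrite subr0.
case: j => [|j] kj; first by rewrite addnS in kj.
have kj' : (j0 + k <= j)%N by rewrite addnS in kj.
apply: (tor_van_mod (x := s`_k) (W := quo_sub W (take k s))).
- exact: sreg.
- by move=> v; rewrite (take_nth 0) //; apply: quo_sub_rcons.
- by apply: IH => //; apply: ltnW.
- by apply: IH (leqW kj'); apply: ltnW.
Qed.

End Tor.
End Complexes.
(** * Tor over a ring whose maximal ideal decomposes *)

Section Decomposable.
Variables (R : comNzRingType) (m : idealr R).
Hypothesis Rloc : local_ring m.
Variables (b : nat -> nat) (d : forall i, 'M[R]_(b i.+1, b i)).
Hypothesis dd : forall i, d i.+1 *m d i = 0.

(** If P / Q is nonzero and killed by J, then J / c is a direct summand in a
    syzygy of P / Q over R / c.  So the vanishing of Tor passes from P / Q to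
    J / c with a loss of one degree. *)
Lemma tor_van_residual_summand (I J c : submod R^o) (V : lmodType R)
    (P Q : submod V) s j :
  (forall a, c a -> J a) -> (forall a, I a -> J a -> c a) ->
  (forall a, a \in m -> exists2 x, I x & J (a - x)) ->
  (forall v, P v <-> span Q s v) -> (exists2 v, P v & ~ Q v) ->
  (forall a v, J a -> P v -> Q (a *: v)) ->
  tor_van d (full_sub R^o) c j -> tor_van d P Q j.+1 -> tor_van d J c j.
Proof.
move=> cJ IJc mIJ PE [v0 Pv0 Qv0] JPQ Tc TPQ v Jv cv.
have [n [u [Pu uP urel]]] := min_gens Rloc PE.
case: n => [|n] in u Pu uP urel *.
  by have [e] := uP v0 Pv0; rewrite big_ord0 subr0.
have [//|//|w _ wP] := Tc v.
(* The cycle v, placed on the first generator, becomes a boundary there. *)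
have [k|l|z Pz zP] := TPQ (fun k => (w k : R) *: u ord0); first exact: smemZ.
  have -> : vmul (fun k => (w k : R) *: u ord0) (d j.+1) l =
            (vmul w (d j.+1) l : R) *: u ord0.
    by rewrite scaler_suml; apply: eq_bigr => k _; rewrite scalerA.
  apply: JPQ => //; apply: smem_sub (Jv l).
  by rewrite -opprB; apply/(smemN (P := J))/cJ.
have /choice[y yP] : forall k, exists y : 'I_n.+1 -> R, Q (z k - \sum_i y i *: u i).
  by move=> k; apply: uP.
pose w' k : R^o := w k - vmul (fun l => y l ord0 : R^o) (d j.+2) k.
(* w' k is the first coefficient in a relation between the generators. *)
have w'm k : (w' k : R) \in m.
  pose r i : R := (i == ord0)%:R * w k - \sum_l d j.+2 l k * y l i.
  suff /urel/(_ ord0) : Q (\sum_i r i *: u i) by rewrite /r eqxx mul1r.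
  have -> : \sum_i r i *: u i =
     (w k : R) *: u ord0 - vmul z (d j.+2) k
     + vmul (fun l => z l - \sum_i y l i *: u i) (d j.+2) k.
    under eq_bigr do rewrite scalerBl scaler_suml.
    rewrite vmulB addrA subrK sumrB (bigD1 ord0) //= mul1r big1 ?addr0; last first.
      by move=> i /negbTE ->; rewrite mul0r scale0r.
    congr (_ - _); rewrite exchange_big; apply: eq_bigr => l _.
    by rewrite scaler_sumr; apply: eq_bigr => i _; rewrite scalerA.
  by apply: smemD => //; apply: smem_vmul.
have /choice[x xP] : forall k, exists x : R^o, I x /\ J (w' k - x).
  by move=> k; have [x Ix Jx] := mIJ _ (w'm k); exists x.
exists (fun k => w' k - x k) => k; first by case: (xP k).
have w'P : c (v k - vmul w' (d j.+1) k).
  by rewrite vmulB vmul_mul dd vmul0 subr0.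
have eq1 : v k - vmul (fun l => w' l - x l) (d j.+1) k =
           v k - vmul w' (d j.+1) k + vmul x (d j.+1) k.
  by rewrite vmulB opprB addrA addrAC.
rewrite eq1; apply: smemD => //; apply: IJc; first by apply: smem_vmul => l; case: (xP l).
have -> : vmul x (d j.+1) k =
    v k - vmul (fun l => w' l - x l) (d j.+1) k - (v k - vmul w' (d j.+1) k).
  by rewrite eq1 addrAC subrr add0r.
apply: smemB; last exact: cJ.
by apply: smemB => //; apply: smem_vmul => l; case: (xP l).
Qed.

(** m / c is the direct sum of I / c and J / c. *)
Lemma tor_van_sum (I J c : submod R^o) j :
  (forall a, c a -> J a) -> (forall a, I a -> J a -> c a) ->
  (forall a, a \in m <-> exists2 x, I x & J (a - x)) ->
  tor_van d I c j -> tor_van d J c j -> tor_van d (ideal_sub m) c j.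
Proof.
move=> cJ IJc mIJ TI TJ v mv cv.
have /choice[x xP] : forall k, exists x : R^o, I x /\ J (v k - x).
  by move=> k; have /mIJ[x Ix Jx] := mv k; exists x.
have xc l : c (vmul x (d j) l).
  apply: IJc; first by apply: smem_vmul => k; case: (xP k).
  have -> : vmul x (d j) l = vmul v (d j) l - vmul (fun k => v k - x k) (d j) l.
    by rewrite vmulB opprB addrC subrK.
  by apply: smemB; [apply: cJ | apply: smem_vmul => k; case: (xP k)].
have [k|//|w1 Iw wP1] := TI x; first by case: (xP k).
have [k|l|w2 Jw wP2] := TJ (fun k => v k - x k); first by case: (xP k).
  by rewrite vmulB; apply: smemB.
exists (fun k => w1 k + w2 k) => k.
  by apply/mIJ; exists (w1 k) => //; rewrite [w1 k + _]addrC addrK.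
have -> : v k - vmul (fun l => w1 l + w2 l) (d j.+1) k =
  (x k - vmul w1 (d j.+1) k) + (v k - x k - vmul w2 (d j.+1) k).
  by rewrite vmulD opprD addrACA [x k + _]addrC subrK.
exact: smemD.
Qed.

Lemma tor_van_residue_field (c : submod R^o) j :
  (forall a, c a -> a \in m) ->
  tor_van d (full_sub R^o) c j.+1 -> tor_van d (ideal_sub m) c j ->
  tor_van d (full_sub R^o) (ideal_sub m) j.+1.
Proof.
move=> cm Tc Tm v _ mv.
have [//|l|w mw wP] := Tm (vmul v (d j.+1)).
  by rewrite vmul_mul dd vmul0; apply: smem0.
have [//|l|z _ zP] := Tc (fun k => v k - w k); first by rewrite vmulB.
exists z => // k; rewrite -[v k](subrK (w k)) addrAC.
exact: (smemD (P := ideal_sub m) (cm _ (zP k)) (mw k)).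
Qed.

(** P1 / Q is a direct summand of P / Q. *)
Lemma tor_van_direct (V : lmodType R) (P1 P2 P Q : submod V) j :
  (forall v, P1 v -> P v) -> (forall v, Q v -> P1 v) ->
  (forall v, P v -> exists2 u, P1 u & P2 (v - u)) ->
  (forall v, P1 v -> P2 v -> Q v) ->
  tor_van d P Q j -> tor_van d P1 Q j.
Proof.
move=> P1P QP1 Pdec P12 T v Pv Qv.
have [k|//|w Pw wP] := T v; first exact: P1P.
have /choice[x xP] : forall k, exists x, P1 x /\ P2 (w k - x).
  by move=> k; have [x Ix Jx] := Pdec _ (Pw k); exists x.
exists x => k; first by case: (xP k).
have P1e : P1 (v k - vmul x (d j.+1) k).
  by apply: smemB => //; apply: smem_vmul => l; case: (xP l).
have -> : v k - vmul x (d j.+1) k =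
  (v k - vmul w (d j.+1) k) + vmul (fun l => w l - x l) (d j.+1) k.
  by rewrite vmulB addrA subrK.
apply: smemD => //; apply: P12; last by apply: smem_vmul => l; case: (xP l).
have -> : vmul (fun l => w l - x l) (d j.+1) k =
  (v k - vmul x (d j.+1) k) - (v k - vmul w (d j.+1) k).
  by rewrite vmulB opprB [RHS]addrC addrA subrK.
by apply: smemB => //; apply: QP1.
Qed.

Lemma full_fg1 : forall v : R^o, span (zero_sub R^o) [:: (1 : R^o)] v.
Proof. by move=> v; exists v; rewrite /= [_ *: _]mulr1 subrr. Qed.

Lemma sub_fg_full (V : lmodType R) s : (forall v, span (zero_sub V) s v) ->
  forall P Q : submod V, (forall v, Q v -> P v) ->
  exists s', forall v, P v <-> span Q s' v.
Proof.
move=> sV P Q QP; apply: (sub_fg (local_noeth Rloc) (s := s) QP) => v _.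
by apply: span_sub (sV v) => [_ ->|u]; [apply: smem0 | apply: span_gen].
Qed.

(** From a nonzero P / Q killed by J the vanishing passes to J / c, and from
    there to I / c, since J / c is nonzero and killed by I. *)
Lemma summands_tor_van (I J c : submod R^o) (V : lmodType R) (P Q : submod V) s j :
  (forall a, c a -> I a) -> (forall a, c a -> J a) ->
  (forall a, I a -> J a -> c a) ->
  (forall a, a \in m <-> exists2 x, I x & J (a - x)) ->
  (exists2 a, J a & ~ c a) ->
  (forall v, span (zero_sub V) s v) -> (forall v, Q v -> P v) ->
  (exists2 v, P v & ~ Q v) -> (forall a v, J a -> P v -> Q (a *: v)) ->
  (forall i, (j <= i)%N -> tor_van d (full_sub R^o) c i) ->
  (forall i, (j <= i)%N -> tor_van d P Q i) ->
  forall i, (j <= i)%N -> tor_van d (ideal_sub m) c i.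
Proof.
move=> cI cJ IJc mIJ Jc sV QP PQ JPQ Tc TPQ.
have IJ (a x : R) : I a -> J x -> c (a * x).
  move=> Ia Jx; apply: IJc; last exact: (smemZ a Jx).
  by rewrite mulrC; apply: (smemZ x Ia).
have TJ i : (j <= i)%N -> tor_van d J c i.
  have [s' PE] := sub_fg_full sV QP.
  move=> ji; apply: (tor_van_residual_summand cJ IJc) PE _ _ _ _ => //.
  - by move=> a /mIJ.
  - exact: Tc.
  - by apply: TPQ; apply: leqW.
have TI i : (j <= i)%N -> tor_van d I c i.
  have [s' PE] := sub_fg_full full_fg1 cJ.
  move=> ji; apply: (tor_van_residual_summand (I := J) cI _ _ PE) => //.
  - by move=> a Ja Ia; apply: IJc.
  - move=> a /mIJ[x Ix Jx]; exists (a - x) => //.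
    by rewrite opprB addrC subrK.
  - exact: Tc.
  - by apply: TJ; apply: leqW.
by move=> i ji; apply: (tor_van_sum cJ IJc) => //; [apply: TI | apply: TJ].
Qed.

(** If Tor vanishes against a nonzero module that is the sum of a module
    killed by J and one killed by I, then the complex is bounded. *)
Lemma decomposable_bounded (I J c : submod R^o) (V : lmodType R)
    (P1 P2 P Q : submod V) s j :
  (forall i k l, d i k l \in m) ->
  (forall a, c a -> I a) -> (forall a, c a -> J a) ->
  (forall a, I a -> J a -> c a) ->
  (forall a, a \in m <-> exists2 x, I x & J (a - x)) ->
  (exists2 a, I a & ~ c a) -> (exists2 a, J a & ~ c a) ->
  (forall v, span (zero_sub V) s v) ->
  (forall v, P1 v -> P v) -> (forall v, P2 v -> P v) ->
  (forall v, Q v -> P1 v) -> (forall v, Q v -> P2 v) ->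
  (forall v, P v -> exists2 u, P1 u & P2 (v - u)) ->
  (forall v, P1 v -> P2 v -> Q v) ->
  (forall a v, J a -> P1 v -> Q (a *: v)) ->
  (forall a v, I a -> P2 v -> Q (a *: v)) ->
  (exists2 v, P v & ~ Q v) ->
  (forall i, (j <= i)%N -> tor_van d (full_sub R^o) c i) ->
  (forall i, (j <= i)%N -> tor_van d P Q i) ->
  forall i, (j.+2 <= i)%N -> b i = 0%N.
Proof.
move=> dm cI cJ IJc mIJ Ic Jc sV P1P P2P QP1 QP2 Pdec P12 JP1 IP2 [v0 Pv0 Qv0] Tc TP.
have Tm : forall i, (j <= i)%N -> tor_van d (ideal_sub m) c i.
  have mJI a : a \in m <-> exists2 x, J x & I (a - x).
    rewrite mIJ; split=> [[x Ix Jx]|[x Jx Ix]]; exists (a - x) => //;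
      by rewrite opprB addrC subrK.
  have [[v P1v Qv]|nP1] := pselect (exists2 v, P1 v & ~ Q v).
    apply: (summands_tor_van cI cJ IJc mIJ Jc sV QP1 _ JP1) => //.
      by exists v.
    by move=> i' ji; apply: (tor_van_direct P1P QP1 Pdec P12 (TP _ ji)).
  have [u P1u P2u] := Pdec _ Pv0.
  apply: (summands_tor_van cJ cI _ mJI Ic sV QP2 _ IP2) => //.
  - by move=> a Ja Ia; apply: IJc.
  - exists (v0 - u) => // Qvu; apply: Qv0; apply: smem_sub Qvu _.
    by apply: contrapT => Qu; apply: nP1; exists u.
  - move=> i' ji; apply: (tor_van_direct (P2 := P1) _ _ _ _ (TP _ ji)) => //.
      move=> v /Pdec[w P1w P2w]; exists (v - w) => //.
      by rewrite opprB addrC subrK.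
    by move=> v P2v P1v; apply: P12.
have cm a : c a -> a \in m.
  by move=> ca; apply/mIJ; exists 0; [apply: smem0 | rewrite subr0; apply: cJ].
move=> [|[|i]] //; rewrite !ltnS => ji.
case bi : (b i.+2) => [//|q]; exfalso.
have T := tor_van_residue_field cm (Tc _ (leqW ji)) (Tm _ ji).
have [//|l|w _ wP] := T (fun=> (1 : R)).
  apply: (smem_sum (P := ideal_sub m)) => k _ /=.
  by rewrite [_ *: _]mulr1; apply: dm.
have o : 'I_(b i.+2) by rewrite bi; apply: ord0.
have := wP o; rewrite /= => h; case/negP: (max1 m).
rewrite -(subrK (vmul w (d i.+2) o) (1 : R)); apply: rpredD => //.
apply: (smem_sum (P := ideal_sub m)) => k _ /=.
by rewrite [_ *: _]mulrC; apply: idealMr; apply: dm.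
Qed.

End Decomposable.
(** * Minimal free resolutions *)

Section MinimalResolutions.
Variables (R : comNzRingType) (m : idealr R).

(** The linear map from R^n to V that sends the basis to g. *)
Definition comb (V : lmodType R) n (g : 'I_n -> V) (c : 'rV[R]_n) : V :=
  \sum_k c 0 k *: g k.

Lemma comb_is_linear (V : lmodType R) n (g : 'I_n -> V) : linear (comb g).
Proof.
move=> a u v; rewrite /comb scaler_sumr -big_split; apply: eq_bigr => k _.
by rewrite !mxE scalerDl scalerA.
Qed.

HB.instance Definition _ (V : lmodType R) n (g : 'I_n -> V) :=
  GRing.isLinear.Build R 'rV[R]_n V *:%R (comb g) (comb_is_linear g).

Lemma comb_delta (V : lmodType R) n (g : 'I_n -> V) k : comb g (delta_mx 0 k) = g k.
Proof.
rewrite /comb (bigD1 k) //= mxE !eqxx scale1r big1 ?addr0 // => i /negbTE ik.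
by rewrite mxE ik andbF scale0r.
Qed.

Lemma comb_lin (V : lmodType R) n (f : {linear 'rV[R]_n -> V}) c :
  f c = comb (fun k => f (delta_mx 0 k)) c.
Proof.
rewrite {1}(row_sum_delta c) linear_sum; apply: eq_bigr => k _.
by rewrite linearZ.
Qed.

Lemma comb_vmul (V : lmodType R) n p (g : 'I_p -> V) (A : 'M[R]_(n, p)) c :
  comb g (c *m A) = comb (fun k => comb g (row k A)) c.
Proof.
by rewrite [c *m A]mulmx_sum_row linear_sum; apply: eq_bigr => k _; rewrite linearZ.
Qed.

(** A minimal free resolution, with the differentials acting on rows. *)
Record minres (V : lmodType R) := Minres {
  mr_rk : nat -> nat;
  mr_mat : forall i, 'M[R]_(mr_rk i.+1, mr_rk i);
  mr_gen : 'I_(mr_rk 0) -> V;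
  mr_surj : forall v, exists c, v = comb mr_gen c;
  mr_ker0 : forall c, comb mr_gen c = 0 <-> exists e, c = e *m mr_mat 0;
  mr_kerS : forall i (c : 'rV[R]_(mr_rk i.+1)),
    c *m mr_mat i = 0 <-> exists e, c = e *m mr_mat i.+1;
  mr_min : forall i k l, mr_mat i k l \in m }.

Arguments mr_gen {V} _ _.

Section Theory.
Variables (V : lmodType R) (F : minres V).

Lemma mr_dd i : mr_mat F i.+1 *m mr_mat F i = 0.
Proof.
apply/row_matrixP => k; rewrite row_mul row0; apply/mr_kerS.
by exists (delta_mx 0 k); rewrite rowE.
Qed.

(** Exactness for matrices whose rows are cycles. *)
Lemma mr_exact_mx i p (C : 'M[R]_(p, mr_rk F i.+1)) : C *m mr_mat F i = 0 ->
  exists D, C = D *m mr_mat F i.+1.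
Proof.
move=> C0; have /choice[D DP] : forall k, exists e, row k C = e *m mr_mat F i.+1.
  by move=> k; apply/mr_kerS; rewrite -row_mul C0 row0.
exists (\matrix_k D k); apply/row_matrixP => k.
by rewrite row_mul rowK.
Qed.

Lemma mr_exact0_mx p (C : 'M[R]_(p, mr_rk F 0)) :
  (forall k, comb (mr_gen F) (row k C) = 0) -> exists D, C = D *m mr_mat F 0.
Proof.
move=> C0; have /choice[D DP] : forall k, exists e, row k C = e *m mr_mat F 0.
  by move=> k; apply/mr_ker0.
exists (\matrix_k D k); apply/row_matrixP => k.
by rewrite row_mul rowK.
Qed.

(** A minimal resolution with a zero differential stops there. *)
Lemma mr_stop i : mr_mat F i = 0 -> forall j, (i < j)%N -> mr_rk F j = 0%N.
Proof.
move=> di0; have step j : mr_mat F j = 0 -> mr_rk F j.+1 = 0%N.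
  move=> dj0; have [|D DP] := @mr_exact_mx j _ 1%:M; first by rewrite dj0 mulmx0.
  case rj : (mr_rk F j.+1) => [//|q]; exfalso.
  have o : 'I_(mr_rk F j.+1) by rewrite rj; apply: ord0.
  have /matrixP/(_ o o) := DP; rewrite !mxE eqxx => one.
  have : (1 : R) \in m.
    by rewrite [X in X \in _]one rpred_sum // => k _; apply: idealMr; apply: mr_min.
  by rewrite idealr1.
have dS j : (i <= j)%N -> mr_mat F j = 0.
  move=> /subnKC <-; elim: (j - i)%N => [|k IH]; first by rewrite addn0.
  rewrite addnS; apply/matrixP => r s; have := ltn_ord s.
  by rewrite [X in (_ < X)%N -> _](step _ IH).
by move=> [//|j] ij; apply/step/dS.
Qed.

End Theory.

Hypothesis Rloc : local_ring m.

Lemma span_delta n (c : 'rV[R]_n) :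
  span (zero_sub _) [seq delta_mx 0 k | k : 'I_n] c.
Proof.
rewrite (row_sum_delta c); apply: smem_sum => k _; apply: smemZ.
by apply: span_gen; apply: image_f.
Qed.

(** A minimal presentation of a kernel: the rows of B generate it, and the
    relations between them have coefficients in m. *)
Lemma ker_min n (V : lmodType R) (f : {linear 'rV[R]_n -> V}) :
  exists r (B : 'M[R]_(r, n)), (forall c, f c = 0 <-> exists e, c = e *m B) /\
    forall e : 'rV_r, e *m B = 0 -> forall k, e 0 k \in m.
Proof.
pose K := preim_sub f (zero_sub V).
have [|s sP] := sub_fg (local_noeth Rloc) (P := K) (Q := zero_sub _) _
  (fun c _ => span_delta c).
  by move=> _ ->; apply: smem0.
have [r [u [Ku uP urel]]] := min_gens Rloc sP.
have uB (e : 'I_r -> R) : (\row_k e k) *m (\matrix_k u k) = \sum_k e k *: u k.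
  by rewrite mulmx_sum_row; apply: eq_bigr => k _; rewrite mxE rowK.
exists r, (\matrix_k u k); split=> [c|e e0].
  split=> [/uP[e /eqP]|[e ->]].
    by rewrite subr_eq0 => /eqP ->; exists (\row_k e k); rewrite uB.
  rewrite mulmx_sum_row linear_sum big1 // => k _.
  by rewrite linearZ_LR rowK (Ku k : f (u k) = 0) scaler0.
apply: (urel (fun k => e 0 k)); rewrite /= -uB -[RHS]e0; congr (_ *m _).
by apply/rowP => k; rewrite mxE.
Qed.

Definition next_rk n p (A : 'M[R]_(n, p)) : nat :=
  projT1 (cid (ker_min (mulmxr A : {linear 'rV[R]_n -> 'rV[R]_p}))).

Definition next_mx n p (A : 'M[R]_(n, p)) : 'M[R]_(next_rk A, n) :=
  projT1 (cid (projT2 (cid (ker_min (mulmxr A : {linear 'rV[R]_n -> 'rV[R]_p}))))).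

Lemma next_mxP n p (A : 'M[R]_(n, p)) :
  (forall c : 'rV_n, c *m A = 0 <-> exists e, c = e *m next_mx A) /\
  forall e : 'rV_(next_rk A), e *m next_mx A = 0 -> forall k, e 0 k \in m.
Proof. exact: projT2 (cid (projT2 (cid (ker_min (mulmxr A))))). Qed.

(** The iterated kernels of A: at each stage a matrix and its two sizes. *)
Fixpoint ker_iter n p (A : 'M[R]_(n, p)) (i : nat) :
  {q : nat & {r : nat & 'M[R]_(q, r)}} :=
  if i is i'.+1 then
    let s := ker_iter A i' in
    existT _ (next_rk (projT2 (projT2 s))) (existT _ (projT1 s) (next_mx (projT2 (projT2 s))))
  else existT _ n (existT _ p A).

Theorem minres_exists (V : lmodType R) : fin_gen V -> inhabited (minres V).
Proof.
move=> [n0 [g0 g0P]].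
have [|n [g [_ gP grel]]] := min_gens Rloc (V := V) (P := full_sub V)
   (Q := zero_sub V) (s := codom g0).
  move=> v; split=> // _; have [c ->] := g0P v; apply: smem_sum => k _.
  by apply/smemZ/span_gen/codom_f.
have [r [B [Bker Brel]]] := ker_min (comb g : {linear 'rV[R]_n -> V}).
pose S i := ker_iter B i.
pose rk i := projT1 (projT2 (S i)).
pose mat i : 'M[R]_(rk i.+1, rk i) := projT2 (projT2 (S i)).
have matS i : (forall c : 'rV[R]_(rk i.+1), c *m mat i = 0 <-> exists e, c = e *m mat i.+1) /\
              forall e : 'rV[R]_(rk i.+2), e *m mat i.+1 = 0 -> forall k, e 0 k \in m.
  exact: next_mxP.
constructor; apply: (@Minres V rk mat g) => //.
- move=> v; have [//|c /eqP] := gP v; rewrite subr_eq0 => /eqP ->.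
  by exists (\row_k c k); apply: eq_bigr => k _; rewrite mxE.
- by move=> i; have [] := matS i.
- move=> [|i] k l.
    apply: (grel (fun j => B k j)).
    have /Bker e : exists e, row k B = e *m B by exists (delta_mx 0 k); rewrite rowE.
    by rewrite /= -[RHS]e; apply: eq_bigr => j _; rewrite mxE.
  have -> : mat i.+1 k l = row k (mat i.+1) 0 l by rewrite mxE.
  case: i k l => [|i] k l.
    apply: Brel; apply/(matS 0).1; exists (delta_mx 0 k); rewrite rowE //.
  by apply: (matS i).2; apply/(matS i.+1).1; exists (delta_mx 0 k); rewrite rowE.
Qed.

End MinimalResolutions.

Arguments mr_gen {R m V} _ _.
(** * Quotient modules and comparison of resolutions *)

Section QuotientModule.
Variables (R : comNzRingType) (V : lmodType R) (Q : submod V).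

Definition quo_pred : V -> bool := fun v => `[< Q v >].

Lemma quo_pred_closed : zmod_closed quo_pred.
Proof.
split; first by apply/asboolP; apply: smem0.
by move=> u v /asboolP Qu /asboolP Qv; apply/asboolP; apply: smemB.
Qed.

Definition quo_closed : zmodClosed V :=
  HB.pack quo_pred (GRing.isZmodClosed.Build V quo_pred quo_pred_closed).

(** The quotient module V / Q. *)
Definition quo : Type := Quotient.quot quo_closed.

HB.instance Definition _ := GRing.Zmodule.on quo.

Definition quo_pi (v : V) : quo := \pi_(Quotient.quot quo_closed)%qT v.

Lemma quo_piP u v : quo_pi u = quo_pi v <-> Q (u - v).
Proof.
split=> [/eqP|Quv].
  by rewrite -Quotient.idealrBE => /asboolP.
by apply/eqP; rewrite -Quotient.idealrBE; apply/asboolP.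
Qed.

Lemma quo_pi_surj x : exists v, quo_pi v = x.
Proof. by exists (repr x); apply: reprK. Qed.

Lemma quo_piD u v : quo_pi (u + v) = quo_pi u + quo_pi v.
Proof. exact: (raddfD (\pi_(Quotient.quot quo_closed))%qT). Qed.

(** Scaling is defined on chosen representatives. *)
Definition quo_scale (a : R) (x : quo) : quo := quo_pi (a *: projT1 (cid (quo_pi_surj x))).

Lemma quo_scaleE a v : quo_scale a (quo_pi v) = quo_pi (a *: v).
Proof.
rewrite /quo_scale; case: cid => u /= /quo_piP uv; apply/quo_piP.
by rewrite -scalerBr; apply: smemZ.
Qed.

Lemma quo_scaleA a c x : quo_scale a (quo_scale c x) = quo_scale (a * c) x.
Proof. by have [v <-] := quo_pi_surj x; rewrite !quo_scaleE scalerA. Qed.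

Lemma quo_scale1 : left_id 1 quo_scale.
Proof. by move=> x; have [v <-] := quo_pi_surj x; rewrite !quo_scaleE scale1r. Qed.

Lemma quo_scaleDr : right_distributive quo_scale +%R.
Proof.
move=> a x y; have [v <-] := quo_pi_surj x; have [u <-] := quo_pi_surj y.
by rewrite -quo_piD !quo_scaleE -quo_piD scalerDr.
Qed.

Lemma quo_scaleDl x : {morph quo_scale^~ x : a c / a + c}.
Proof.
move=> a c; have [v <-] := quo_pi_surj x.
by rewrite !quo_scaleE -quo_piD scalerDl.
Qed.

HB.instance Definition _ := GRing.Zmodule_isLmodule.Build R quo
  quo_scaleA quo_scale1 quo_scaleDr quo_scaleDl.

Lemma quo_pi_linear : linear quo_pi.
Proof. by move=> a u v; rewrite quo_piD -quo_scaleE. Qed.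

HB.instance Definition _ := GRing.isLinear.Build R V quo *:%R quo_pi quo_pi_linear.

Lemma quo_pi0 v : quo_pi v = 0 <-> Q v.
Proof. by rewrite -(linear0 quo_pi) quo_piP subr0. Qed.

End QuotientModule.

Section Comparison.
Variable R : comNzRingType.

(** Lifting a map through g needs only that its values lie in the image of g:
    lift it through A -> A / ker g, which is onto. *)
Lemma projective_lift (P A B : lmodType R) (f : {linear P -> B}) (g : {linear A -> B}) :
  projective P -> (forall p, exists a, g a = f p) ->
  exists h : {linear P -> A}, forall p, g (h p) = f p.
Proof.
move=> Pproj /choice[e eP].
pose K := preim_sub g (zero_sub B).
pose f' p : quo K := quo_pi K (e p).
have f'_lin : linear f'.
  move=> a u v; rewrite /f' -linearP; apply/quo_piP.
  by rewrite /= linearB linearP !eP linearP subrr.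
pose F : {linear P -> quo K} := HB.pack f' (GRing.isLinear.Build R P (quo K) *:%R f' f'_lin).
have [h hP] := Pproj A (quo K) (quo_pi K) F (@quo_pi_surj _ _ K).
exists h => p; have /quo_piP := hP p.
by rewrite /= linearB eP => /eqP; rewrite subr_eq0 => /eqP.
Qed.

Lemma projective_rV n : projective 'rV[R]_n.
Proof.
move=> A B g f gsurj.
have /choice[e eP] : forall k, exists a, g a = f (delta_mx 0 k) by move=> k; apply: gsurj.
exists (comb e) => c; rewrite [RHS]comb_lin linear_sum; apply: eq_bigr => k _.
by rewrite linearZ_LR eP.
Qed.

Lemma res_dd (V : lmodType R) (P : proj_resolution V) i q :
  res_diff P i (res_diff P i.+1 q) = 0.
Proof. by apply/res_exactS; exists q. Qed.

Lemma res_aug_d (V : lmodType R) (P : proj_resolution V) q :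
  res_aug P (res_diff P 0 q) = 0.
Proof. by apply/res_exact0; exists q. Qed.

Lemma res_liftS (V : lmodType R) (P : proj_resolution V) (X : lmodType R) i
    (f : {linear X -> res_mod P i.+1}) :
  projective X -> (forall x, res_diff P i (f x) = 0) ->
  exists h : {linear X -> res_mod P i.+2}, forall x, res_diff P i.+1 (h x) = f x.
Proof. by move=> Xproj df; apply: projective_lift => // x; apply/res_exactS. Qed.

Lemma res_lift0 (V : lmodType R) (P : proj_resolution V) (X : lmodType R)
    (f : {linear X -> res_mod P 0}) :
  projective X -> (forall x, res_aug P (f x) = 0) ->
  exists h : {linear X -> res_mod P 1}, forall x, res_diff P 0 (h x) = f x.
Proof. by move=> Xproj df; apply: projective_lift => // x; apply/res_exact0. Qed.

(** Comparison maps a, b between two resolutions in degrees j and j + 1, with a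
    homotopy h0 in degree j up to a map that vanishes on boundaries. *)
Lemma res_compare_weak (V : lmodType R) (P P' : proj_resolution V) (j : nat) :
  exists (a0 : {linear res_mod P j -> res_mod P' j})
         (a1 : {linear res_mod P j.+1 -> res_mod P' j.+1})
         (b0 : {linear res_mod P' j -> res_mod P j})
         (b1 : {linear res_mod P' j.+1 -> res_mod P j.+1})
         (h0 : {linear res_mod P j -> res_mod P j.+1}),
    [/\ forall p, res_diff P' j (a1 p) = a0 (res_diff P j p),
        forall p, res_diff P j (b1 p) = b0 (res_diff P' j p) &
        forall p, b0 (a0 (res_diff P j p)) - res_diff P j p =
          res_diff P j (h0 (res_diff P j p))].
Proof.
elim: j => [|j [a0 [a1 [b0 [b1 [h0 [da db dh]]]]]]].
  have [a0 a0P] := @projective_lift _ _ _ (res_aug P) (res_aug P')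
    (@res_projective _ _ P 0) (fun p => res_aug_surj P' _).
  have [b0 b0P] := @projective_lift _ _ _ (res_aug P') (res_aug P)
    (@res_projective _ _ P' 0) (fun p => res_aug_surj P _).
  have [a1 a1P] := @res_lift0 _ P' _ (a0 \o res_diff P 0) (@res_projective _ _ P 1)
    (fun p => etrans (a0P _) (res_aug_d p)).
  have [b1 b1P] := @res_lift0 _ P _ (b0 \o res_diff P' 0) (@res_projective _ _ P' 1)
    (fun p => etrans (b0P _) (res_aug_d p)).
  have [|h0 h0P] := @res_lift0 _ P _ ((b0 \o a0) \- idfun) (@res_projective _ _ P 0).
    by move=> p; rewrite /= linearB /= b0P a0P subrr.
  by exists a0, a1, b0, b1, h0; split=> // p; rewrite h0P.
have [|a2 a2P] := @res_liftS _ P' _ _ (a1 \o res_diff P j.+1) (@res_projective _ _ P j.+2).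
  by move=> p; rewrite /= da res_dd linear0.
have [|b2 b2P] := @res_liftS _ P _ _ (b1 \o res_diff P' j.+1) (@res_projective _ _ P' j.+2).
  by move=> p; rewrite /= db res_dd linear0.
have [|h1 h1P] := @res_liftS _ P _ _ ((b1 \o a1 \- idfun) \- (h0 \o res_diff P j))
    (@res_projective _ _ P j.+1).
  by move=> p; rewrite /= !linearB /= db da dh subrr.
exists a1, a2, b1, b2, h1; split=> // p; rewrite h1P /= res_dd linear0 subr0 //.
Qed.

(** The same with a genuine homotopy, in degree j + 1. *)
Lemma res_compare (V : lmodType R) (P P' : proj_resolution V) (j : nat) :
  exists (a0 : {linear res_mod P j -> res_mod P' j})
         (a1 : {linear res_mod P j.+1 -> res_mod P' j.+1})
         (b1 : {linear res_mod P' j.+1 -> res_mod P j.+1})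
         (b2 : {linear res_mod P' j.+2 -> res_mod P j.+2})
         (h0 : {linear res_mod P j -> res_mod P j.+1})
         (h1 : {linear res_mod P j.+1 -> res_mod P j.+2}),
    [/\ forall p, res_diff P' j (a1 p) = a0 (res_diff P j p),
        forall p, res_diff P j.+1 (b2 p) = b1 (res_diff P' j.+1 p) &
        forall p, b1 (a1 p) = p + res_diff P j.+1 (h1 p) + h0 (res_diff P j p)].
Proof.
have [a0 [a1 [b0 [b1 [h0 [da db dh]]]]]] := res_compare_weak P P' j.
have [|b2 b2P] := @res_liftS _ P _ _ (b1 \o res_diff P' j.+1) (@res_projective _ _ P' j.+2).
  by move=> p; rewrite /= db res_dd linear0.
have [|h1 h1P] := @res_liftS _ P _ _ ((b1 \o a1 \- idfun) \- (h0 \o res_diff P j))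
    (@res_projective _ _ P j.+1).
  by move=> p; rewrite /= !linearB /= db da dh subrr.
exists a0, a1, b1, b2, h0, h1; split=> // p.
by rewrite h1P /= -addrA subrK addrC subrK.
Qed.

(** The vanishing of Ext^(j+1)(V, W) can be read off any resolution of V. *)
Lemma Ext_zero_any (V W : lmodType R) (P : proj_resolution V) j :
  Ext_zero j.+1 V W -> forall f : {linear res_mod P j.+1 -> W},
    (forall p, f (res_diff P j.+1 p) = 0) ->
    exists g : {linear res_mod P j -> W}, forall p, f p = g (res_diff P j p).
Proof.
move=> [P' EP'] f fd.
have [a0 [a1 [b1 [b2 [h0 [h1 [da db dh]]]]]]] := res_compare P P' j.
have [|g gP] := EP' (f \o b1); first by move=> p; rewrite /= -db.
exists ((g \o a0) \- (f \o h0)) => p.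
have := gP (a1 p); rewrite /= dh !linearD /= fd addr0 da => <-.
by rewrite addrK.
Qed.

End Comparison.

Section MinresResolution.
Variables (R : comNzRingType) (m : idealr R) (V : lmodType R) (F : minres m V).

(** The minimal resolution as a projective resolution. *)
Definition mr_resolution : proj_resolution V.
Proof.
refine (@ProjResolution R V (fun i => 'rV[R]_(mr_rk F i) : lmodType R)
  (fun i => mulmxr (mr_mat F i) : {linear 'rV[R]_(mr_rk F i.+1) -> 'rV[R]_(mr_rk F i)})
  (comb (mr_gen F) : {linear 'rV[R]_(mr_rk F 0) -> V}) _ _ _ _).
- by move=> i; apply: projective_rV.
- by move=> v; have [c ->] := mr_surj F v; exists c.
- move=> c; rewrite mr_ker0; split=> [[e ->]|[e <-]]; by exists e.
- move=> i c; rewrite /= mr_kerS; split=> [[e ->]|[e <-]]; by exists e.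
Defined.

Lemma mr_finite_pd n : (forall j, (n < j)%N -> mr_rk F j = 0%N) -> finite_pd V.
Proof.
move=> Fn; exists mr_resolution, n => i /Fn rki p; apply/rowP => k.
by have := ltn_ord k; rewrite [X in (_ < X)%N -> _]rki.
Qed.

(** Ext^(j+1)(V, W) = 0 in terms of the transposed differentials. *)
Lemma mr_Ext_zero (W : lmodType R) j : Ext_zero j.+1 V W ->
  forall y : 'I_(mr_rk F j.+1) -> W,
    (forall l, comb y (row l (mr_mat F j.+1)) = 0) ->
    exists g : 'I_(mr_rk F j) -> W, forall l, y l = comb g (row l (mr_mat F j)).
Proof.
move=> E y yd; have [|g gP] := Ext_zero_any (P := mr_resolution) E (f := comb y).
  by move=> p; rewrite /= comb_vmul /comb big1 // => k _; rewrite -/(comb _ _) yd scaler0.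
exists (fun k => g (delta_mx 0 k)) => l.
by rewrite -comb_lin -(comb_delta y) gP /= rowE.
Qed.

Lemma mr_free : mr_rk F 1 = 0%N -> free_module V.
Proof.
move=> F1; exists (mr_rk F 0), (comb (mr_gen F)).
have inj : injective (comb (mr_gen F)).
  move=> c c' /eqP; rewrite -subr_eq0 -linearB => /eqP/mr_ker0[e ce].
  apply/eqP; rewrite -subr_eq0 ce; apply/eqP/rowP => k; rewrite mxE big1 ?mxE // => i.
  by have := ltn_ord i; rewrite [X in (_ < X)%N -> _]F1.
have /choice[g gP] := mr_surj F.
by exists g => [c|v]; [apply: inj|]; apply: (esym (gP _)).
Qed.

End MinresResolution.

(** * Tor computed from a minimal resolution *)

Section TorComparison.
Variables (R : comNzRingType) (m : idealr R) (N : lmodType R) (G : minres m N).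
Variable Z : lmodType R.

(** The model Z^n of the tensor product of R^n and Z. *)
Local Notation tens n := {ffun 'I_n -> Z}.

Definition pure n (u : 'rV[R]_n) (z : Z) : tens n := [ffun k => u 0 k *: z].

Lemma pure_bilinear n : bilinear_for *:%R *:%R (@pure n).
Proof.
split=> [z a u v|u a z z']; apply/ffunP => k; rewrite !ffunE.
  by rewrite !mxE scalerDl scalerA.
by rewrite scalerDr !scalerA mulrC.
Qed.

HB.instance Definition _ n :=
  bilinear_isBilinear.Build R 'rV[R]_n Z (tens n) *:%R *:%R (@pure n) (@pure_bilinear n).

Definition tens_map n p (A : 'M[R]_(n, p)) (v : tens n) : tens p := [ffun l => vmul v A l].

Lemma tens_map_linear n p (A : 'M[R]_(n, p)) : linear (tens_map A).
Proof.
move=> a u v; apply/ffunP => l; rewrite !ffunE -vmulZ -vmulD.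
by apply: eq_vmul => k; rewrite !ffunE.
Qed.

HB.instance Definition _ n p A :=
  GRing.isLinear.Build R (tens n) (tens p) *:%R (@tens_map n p A) (@tens_map_linear n p A).

Lemma tens_map_pure n p (A : 'M[R]_(n, p)) u z :
  tens_map A (pure u z) = pure (u *m A) z.
Proof.
apply/ffunP => l; rewrite !ffunE mxE scaler_suml; apply: eq_bigr => k _.
by rewrite ffunE scalerA mulrC.
Qed.

Lemma tens_sum n (v : tens n) : v = \sum_k pure (delta_mx 0 k) (v k).
Proof.
apply/ffunP => l; rewrite sum_ffunE (bigD1 l) //= big1 ?addr0.
  by rewrite ffunE mxE !eqxx scale1r.
by move=> k /negbTE kl; rewrite ffunE mxE eq_sym kl andbF scale0r.
Qed.

Lemma pure_is_tensor n : is_tensor (@pure n : {bilinear 'rV[R]_n -> Z -> tens n}).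
Proof.
move=> U c; split=> [|h h' hh' v]; last first.
  by rewrite [v]tens_sum !linear_sum; apply: eq_bigr => k _; apply: hh'.
pose h (v : tens n) : U := \sum_k c (delta_mx 0 k) (v k).
have hlin : linear h.
  move=> a u v; rewrite /h scaler_sumr -big_split; apply: eq_bigr => k _.
  by rewrite !ffunE linearPr.
pose H : {linear tens n -> U} := HB.pack h (GRing.isLinear.Build R (tens n) U *:%R h hlin).
exists H => u z; rewrite /H /=.
rewrite /h {2}(row_sum_delta u) linear_sumlz; apply: eq_bigr => k _.
by rewrite ffunE linearZr_LR linearZl_LR.
Qed.

Lemma tor_van_Tor_zero j :
  tor_van (mr_mat G) (full_sub Z) (zero_sub Z) j -> Tor_zero j.+1 N Z.
Proof.
move=> T; exists (mr_resolution G), (fun i => tens (mr_rk G i) : lmodType R),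
  (fun i => @pure (mr_rk G i) : {bilinear 'rV[R]_(mr_rk G i) -> Z -> tens (mr_rk G i)}),
  (fun i => @tens_map _ _ (mr_mat G i) :
     {linear tens (mr_rk G i.+1) -> tens (mr_rk G i)}); split.
- by move=> i; apply: pure_is_tensor.
- by move=> i p w; apply: tens_map_pure.
move=> v /ffunP dv; have [//|l|w _ wP] := T v; first by have := dv l; rewrite !ffunE.
exists [ffun k => w k]; apply/ffunP => k; rewrite ffunE.
have /eqP := wP k; rewrite subr_eq0 => /eqP ->.
by apply: eq_vmul => i; rewrite ffunE.
Qed.

(** The vanishing of Tor for some projective resolution of N implies it for G:
    the comparison maps are tensored with Z. *)
Lemma Tor_zero_tor_van j :
  Tor_zero j.+1 N Z -> tor_van (mr_mat G) (full_sub Z) (zero_sub Z) j.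
Proof.
move=> [P [T [t [D [tP Dt H]]]]] v _ dv.
pose PG := mr_resolution G.
have [a0 [a1 [b1 [b2 [h0 [h1 [da db dh]]]]]]] := res_compare PG P j.
pose d := mr_mat G.
have beta i n (b : {linear res_mod P i -> 'rV[R]_n}) :
    (exists f : {linear T i -> tens n}, forall p z, f (t i p z) = pure (b p) z) /\
    forall f g : {linear T i -> tens n},
      (forall p z, f (t i p z) = g (t i p z)) -> f =1 g.
  pose c p z := pure (b p) z.
  have cP : bilinear_for *:%R *:%R c.
    split=> [z a u w|u a z w]; rewrite /c; last exact: linearPr.
    by rewrite linearP linearPl.
  pose C : {bilinear res_mod P i -> Z -> tens n} :=
    HB.pack c (bilinear_isBilinear.Build R (res_mod P i) Z (tens n) *:%R *:%R c cP).
  have [ex un] := tP i _ C; split; last exact: un.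
  by have [f fP] := ex; exists f.
have [[f1 f1P] _] := beta j.+1 _ b1; have [[f2 f2P] _] := beta j.+2 _ b2.
have fd u : f1 (D j.+1 u) = tens_map (d j.+1) (f2 u).
  have [_ un] := beta j.+2 _ (mulmxr (d j.+1) \o b2).
  apply: (un (f1 \o D j.+1) (@tens_map _ _ (d j.+1) \o f2)) => p z /=.
  by rewrite Dt f1P f2P tens_map_pure -[b2 p *m _]/(res_diff PG j.+1 (b2 p)) db.
(* The cycle v, transported to the other resolution. *)
pose tv := \sum_k t j.+1 (a1 (delta_mx 0 k)) (v k).
have [|u uP] := H tv.
  have da' k : D j (t j.+1 (a1 (delta_mx 0 k)) (v k)) =
      \sum_l t j (a0 (delta_mx 0 l)) (d j k l *: v k).
    rewrite Dt da /= -rowE (row_sum_delta (row k _)) linear_sum linear_sumlz.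
    by apply: eq_bigr => l _; rewrite linearZ_LR linearZl_LR linearZr_LR mxE.
  rewrite /tv linear_sum; under eq_bigr do rewrite da'.
  rewrite exchange_big big1 // => l _; rewrite -linear_sumr.
  by have := dv l; rewrite /= /vmul => ->; rewrite linear0r.
pose H0 : 'M_(mr_rk G j, mr_rk G j.+1) := \matrix_k h0 (delta_mx 0 k).
pose H1 : 'M_(mr_rk G j.+1, mr_rk G j.+2) := \matrix_k h1 (delta_mx 0 k).
have f1tv k : f1 tv k = v k + vmul (vmul v H1) (d j.+1) k.
  have -> : f1 tv k = vmul v (1%:M + H1 *m d j.+1 + d j *m H0) k.
    rewrite /tv linear_sum sum_ffunE; apply: eq_bigr => l _.
    rewrite f1P ffunE dh; congr (_ *: _); rewrite !mxE.
    congr (_ + _ + _); first by rewrite !eqxx /= eq_sym.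
      by apply: eq_bigr => i _; rewrite mxE.
    rewrite /= -rowE (row_sum_delta (row l _)) linear_sum summxE.
    by apply: eq_bigr => i _; rewrite linearZ_LR !mxE.
  have vmulDr (A B : 'M[R]_(mr_rk G j.+1)) :
      vmul v (A + B) k = vmul v A k + vmul v B k.
    by rewrite -big_split; apply: eq_bigr => l _; rewrite mxE scalerDl.
  rewrite !vmulDr -!vmul_mul (eq_vmul (w := fun=> 0) _ _ dv).
  rewrite [X in _ + X]big1 ?addr0; last by move=> l _; rewrite scaler0.
  congr (_ + _); rewrite /vmul (bigD1 k) //= mxE eqxx scale1r big1 ?addr0 //.
  by move=> l /negbTE lk; rewrite mxE lk scale0r.
exists (fun l => f2 u l - vmul v H1 l) => // k /=.
have := congr1 (fun w : tens _ => w k) (fd u); rewrite uP f1tv ffunE vmulB => <-.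
by rewrite addrK subrr.
Qed.

End TorComparison.
(** * Vanishing of Ext against a Tor-rigid module *)

Section Quotients.
Variables (R : comNzRingType) (b : nat -> nat) (d : forall i, 'M[R]_(b i.+1, b i)).
Variables (V : lmodType R) (W : submod V).

Lemma tor_van_quotient j :
  tor_van d (full_sub V) W j <-> tor_van d (full_sub (quo W)) (zero_sub _) j.
Proof.
have lift n (v : 'I_n -> quo W) : exists u : 'I_n -> V, forall k, quo_pi W (u k) = v k.
  have /choice[u uP] : forall k, exists w, quo_pi W w = v k by move=> k; apply: quo_pi_surj.
  by exists u.
split=> T v _ dv.
  have [u uP] := lift _ v.
  have [//|l|w _ wP] := T u.
    by apply/quo_pi0; rewrite linear_vmul -[RHS](dv l); apply: eq_vmul.
  exists (quo_pi W \o w) => // k /=.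
  by rewrite -linear_vmul -uP -linearB; apply/quo_pi0.
have [//|l|w _ wP] := T (quo_pi W \o v).
  by rewrite /= -linear_vmul; apply/quo_pi0.
have [u uP] := lift _ w; exists u => // k; apply/quo_pi0.
rewrite linearB linear_vmul -[RHS](wP k); congr (_ - _).
exact: eq_vmul.
Qed.

Lemma quo_fin_gen s : (forall v, span (zero_sub V) s v) -> fin_gen (quo W).
Proof.
move=> sV; exists (size s), (fun i => quo_pi W s`_i) => x.
have [v <-] := quo_pi_surj x; have /spanE[c /eqP] := sV v.
rewrite subr_eq0 => /eqP ->; exists c; rewrite linear_sum.
by apply: eq_bigr => i _; rewrite linearZ_LR.
Qed.

End Quotients.

Section ExtRigid.
Variables (R : comNzRingType) (m : idealr R).
Hypothesis Rloc : local_ring m.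
Variables (M N : lmodType R) (F : minres m M) (G : minres m N).

Local Notation f := (mr_rk F).
Local Notation del := (mr_mat F).
Local Notation d := (mr_mat G).

Lemma span_delta_col n (c : 'cV[R]_n) :
  span (zero_sub _) [seq delta_mx k 0 | k : 'I_n] c.
Proof.
rewrite (matrix_sum_delta c); apply: smem_sum => k _; rewrite big_ord1.
by apply/smemZ/span_gen/image_f.
Qed.

(** The boundaries in the dual of the resolution of M: the image of
    Hom(F_i, R) in Hom(F_(i+1), R). *)
Definition coboundary i : submod 'cV[R]_(f i.+1) :=
  im_sub (mulmx (del i) : {linear 'cV[R]_(f i) -> 'cV[R]_(f i.+1)}).

(** The matrix whose columns are the values of v. *)
Definition cols q n (v : 'I_n -> 'cV[R]_q) : 'M[R]_(q, n) := \matrix_(i, k) v k i 0.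

Lemma col_cols q n (v : 'I_n -> 'cV[R]_q) k : col k (cols v) = v k.
Proof. by apply/colP => i; rewrite !mxE. Qed.

Lemma col_mul q n p (A : 'M[R]_(q, n)) (B : 'M[R]_(n, p)) k :
  col k (A *m B) = A *m col k B.
Proof. by rewrite !colE mulmxA. Qed.

Lemma vmul_cols q n p (v : 'I_n -> 'cV[R]_q) (A : 'M[R]_(n, p)) l :
  vmul v A l = col l (cols v *m A).
Proof.
apply/colP => i; rewrite !mxE summxE; apply: eq_bigr => k _.
by rewrite !mxE mulrC.
Qed.

(** Tor-rigidity, applied to the finitely generated module R^q / W. *)
Lemma rigid_tor_van q (W : submod 'cV[R]_q) j0 : Tor_rigid N ->
  tor_van d (full_sub _) W j0 ->
  forall j, (j0 <= j)%N -> tor_van d (full_sub _) W j.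
Proof.
move=> Nrig T0 j /subnKC <-; elim: (j - j0)%N => [|i IH]; first by rewrite addn0.
rewrite addnS; apply/tor_van_quotient/Tor_zero_tor_van; apply: Nrig => //.
  by apply: quo_fin_gen; apply: span_delta_col.
by apply: (tor_van_Tor_zero (G := G)); apply: (tor_van_quotient _ _ _).1.
Qed.

Section OneDegree.
Variable j : nat.
Hypothesis EN : Ext_zero j.+1 M N.

(** The form in which the vanishing of Ext is used.  The rows of Z are lifts to
    G_0 of a cochain with values in N.  Its coboundary is zero in N, so Z is the
    sum of a coboundary and of a matrix whose rows are boundaries in G_0. *)
Lemma ext_factor p (Z : 'M[R]_(f j.+1, mr_rk G 0)) (C : 'M[R]_(f j.+2, p))
    (D : 'M[R]_(p, mr_rk G 0)) :
  del j.+1 *m Z = C *m D -> (exists D', D = D' *m d 0) ->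
  exists G' H, Z = del j *m G' + H *m d 0.
Proof.
move=> ZC [D' DD'].
pose y l := comb (mr_gen G) (row l Z).
have [l|g gP] := mr_Ext_zero EN (y := y).
  rewrite -comb_vmul -row_mul ZC DD' mulmxA row_mul.
  by apply/mr_ker0; eexists.
have /choice[g' g'P] : forall i, exists c, g i = comb (mr_gen G) c.
  by move=> i; apply: mr_surj.
have [l|H HP] := @mr_exact0_mx _ _ _ G _ (Z - del j *m \matrix_i g' i).
  rewrite raddfB linearB /= -/(y l) gP row_mul comb_vmul.
  apply/eqP; rewrite subr_eq0; apply/eqP; apply: eq_bigr => i _.
  by rewrite g'P rowK.
by exists (\matrix_i g' i), H; rewrite -HP addrC subrK.
Qed.

(** Ext^(j+1)(M, N) = 0 implies Tor_1(E, N) = 0, where E is the cokernel of the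
    transposed differential Hom(F_(j+1), R) -> Hom(F_(j+2), R). *)
Lemma ext_tor1 : tor_van d (full_sub _) (coboundary j.+1) 0.
Proof.
move=> v _ /choice[e eP].
have VZ : del j.+1 *m cols e = cols v *m d 0.
  apply/matrixP => i k; have := congr1 (fun c : 'cV_ _ => c i 0) (eP k).
  rewrite vmul_cols !mxE => ->; apply: eq_bigr => l _; by rewrite !mxE.
have [|G' [H ZP]] := ext_factor VZ; first by exists 1%:M; rewrite mul1mx.
have [|W WP] := @mr_exact_mx _ _ _ G 0 _ (cols v - del j.+1 *m H).
  rewrite mulmxBl -VZ ZP mulmxDr mulmxA mr_dd mul0mx add0r -mulmxA subrr //.
exists (fun k => col k W) => // k; exists (col k H).
have -> : vmul (fun k => col k W) (d 1) k = col k (W *m d 1).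
  by rewrite vmul_cols; congr (col k (_ *m _)); apply/matrixP => i l; rewrite !mxE.
by rewrite -{1}(col_cols v k) -WP raddfB /= opprB addrC subrK -!col_mul.
Qed.

(** If moreover Tor_2(E, N) = 0, then Ext^(j+1)(M, R) = 0: by Nakayama's lemma
    it suffices that cocycles are coboundaries modulo m times cocycles. *)
Lemma ext_exact : nonzero_module N ->
  tor_van d (full_sub _) (coboundary j.+1) 1 ->
  forall z : 'cV_(f j.+1), del j.+1 *m z = 0 -> exists u, z = del j *m u.
Proof.
move=> [n0 n0P] T2.
have [o _] : exists o : 'I_(mr_rk G 0), True.
  have [c cP] := mr_surj G n0; apply: contrapT => no; case/eqP: n0P.
  by rewrite cP /comb big1 // => k _; case: no; exists k.
pose K := preim_sub
  (mulmx (del j.+1) : {linear 'cV[R]_(f j.+1) -> 'cV[R]_(f j.+2)}) (zero_sub _).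
have BK z : coboundary j z -> K z.
  by case=> u ->; rewrite /= mulmxA mr_dd mul0mx.
have [s sP] := sub_fg_full Rloc (@span_delta_col _) BK.
apply: (nakayama Rloc sP) => z Kz.
(* The cocycle z, placed on the minimal generator of N with index o. *)
have [||G' [H ZP]] := @ext_factor _ (z *m delta_mx 0 o) 0 (0 : 'M_(0, _)).
- by rewrite mulmxA (Kz : del j.+1 *m z = 0) !mul0mx.
- by exists 0; rewrite mul0mx.
have dHd : del j.+1 *m H *m d 0 = 0.
  have /(congr1 (mulmx (del j.+1))) := ZP.
  by rewrite mulmxA (Kz : del j.+1 *m z = 0) mul0mx mulmxDr !mulmxA mr_dd mul0mx add0r.
have [W WP] := mr_exact_mx dHd.
have colW k : vmul (fun k => col k W) (d 1) k = col k (W *m d 1).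
  by rewrite vmul_cols; congr (col k (_ *m _)); apply/matrixP => i l; rewrite !mxE.
have [//|l|W' _ W'P] := T2 (fun k => col k W).
  by rewrite colW -WP; exists (col l H); apply: col_mul.
have /choice[H' H'P] := W'P.
have WE : W = cols W' *m d 2 + del j.+1 *m cols H'.
  apply/matrixP => i k; have := congr1 (fun c : 'cV_ _ => c i 0) (H'P k).
  rewrite vmul_cols => /(congr1 (fun x => (cols W' *m d 2) i k + x)).
  rewrite !mxE addrCA subrr addr0 => ->; congr (_ + _).
  by apply: eq_bigr => l _; rewrite !mxE.
pose H2 := H - cols H' *m d 1.
have H2K k : K (col k H2).
  have: del j.+1 *m H2 = 0.
    by rewrite /H2 mulmxBr WP WE mulmxDl -mulmxA mr_dd mulmx0 add0r mulmxA subrr.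
  move/(congr1 (col k)); rewrite col_mul => e; apply: (etrans e).
  by apply/colP => i; rewrite !mxE.
exists (mr_rk G 1), (fun k => d 0 k o), (fun k => col k H2); split.
- by move=> k; apply: mr_min.
- exact: H2K.
exists (col o G').
have H2d : H2 *m d 0 = H *m d 0 by rewrite /H2 mulmxBl -mulmxA mr_dd mulmx0 subr0.
have -> : \sum_i d 0 i o *: col i H2 = col o (H *m d 0).
  rewrite -H2d; apply/colP => i; rewrite summxE !mxE; apply: eq_bigr => k _.
  by rewrite !mxE mulrC.
have -> : z = col o (z *m delta_mx 0 o).
  by apply/colP => i; rewrite !mxE big_ord1 mxE !eqxx mulr1.
by rewrite ZP raddfD /= addrK -col_mul.
Qed.

End OneDegree.
End ExtRigid.
(** * Regular sequences on the cokernels of the dual complex *)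

Section RegularSequences.
Variable R : comNzRingType.

Lemma smul_col q (s : seq R) (v : 'cV[R]_q) :
  smul_sub 'cV[R]_q s v <-> forall i, smul_sub R^o s (v i 0).
Proof.
split=> [/in_smulE[c ->] i|].
  apply/in_smulE; exists (fun k => c k i 0); rewrite summxE.
  by apply: eq_bigr => k _; rewrite mxE.
have H i : smul_sub R^o s (v i 0) ->
    exists c : nat -> R^o, v i 0 = \sum_(k < size s) s`_k *: c k by move/in_smulE.
move=> vs; have /choice[c cP] := fun i => H i (vs i).
apply/in_smulE; exists (fun k => \col_i c i k); apply/colP => i.
rewrite cP summxE; by apply: eq_bigr => k _; rewrite !mxE.
Qed.

Lemma quo_sub0 (V : lmodType R) (s : seq R) (v : V) :
  quo_sub (zero_sub V) s v <-> smul_sub V s v.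
Proof.
split=> [[u su /eqP]|sv]; first by rewrite subr_eq0 => /eqP ->.
by exists v => //=; rewrite subrr.
Qed.

Variables (x : seq R).
Hypothesis xreg : forall i, (i < size x)%N -> forall v : R^o,
     in_smul (take i x) (x`_i *: v) -> in_smul (take i x) v.

Lemma regular_col q i : (i < size x)%N -> forall v : 'cV[R]_q,
  smul_sub _ (take i x) (x`_i *: v) -> smul_sub _ (take i x) v.
Proof.
move=> ix v /smul_col H; apply/smul_col => k; apply: xreg => //.
by have := H k; rewrite mxE.
Qed.

Lemma wreg_ring : wreg (zero_sub R^o) x.
Proof. by move=> k kx u /quo_sub0 H; apply/quo_sub0/xreg. Qed.

Lemma wreg_col q : wreg (zero_sub 'cV[R]_q) x.
Proof. by move=> k kx u /quo_sub0 H; apply/quo_sub0/regular_col. Qed.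

(** If s is regular on V / W then W meets (s) V in (s) W. *)
Lemma wreg_inter (V : lmodType R) (W : submod V) : wreg W x ->
  forall v, W v -> smul_sub V x v ->
  exists c : nat -> V, (forall i, W (c i)) /\ v = \sum_(i < size x) x`_i *: c i.
Proof.
move=> Wreg.
suff H k : (k <= size x)%N -> forall v, W v -> smul_sub V (take k x) v ->
    exists c : nat -> V, (forall i, W (c i)) /\ v = \sum_(i < k) x`_i *: c i.
  by move=> v Wv xv; apply: H => //; rewrite take_size.
elim: k => [|k IH] kx v Wv.
  rewrite take0 => /smul_nil ->; exists (fun=> 0); split=> [_|]; first exact: smem0.
  by rewrite big_ord0.
rewrite (take_nth 0) // => /smul_rcons[w sw].
have [s' ss' We] : quo_sub W (take k x) w.
  apply: Wreg => //; exists (- (v - x`_k *: w)); first exact: smemN.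
  by rewrite opprK addrC subrK.
have [||c [Wc cE]] := IH (ltnW kx) (v - x`_k *: (w - s')).
- by apply: smemB => //; apply: smemZ.
- rewrite scalerBr opprB addrA addrAC; apply: smemD => //.
  exact: smemZ.
exists (fun i => if i == k then w - s' else c i); split.
  by move=> i; case: eqP.
rewrite big_ord_recr /= eqxx -[LHS](subrK (x`_k *: (w - s'))) cE; congr (_ + _).
by apply: eq_bigr => i _; rewrite ltn_eqF.
Qed.

Section DualComplex.
Variables (m : idealr R) (M : lmodType R) (F : minres m M).
Local Notation f := (mr_rk F).
Local Notation del := (mr_mat F).

(** Ext^(i+1)(M, R) = 0. *)
Definition dual_exact i := forall z : 'cV[R]_(f i.+1), del i.+1 *m z = 0 ->
  exists u : 'cV[R]_(f i), z = del i *m u.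

(** The map induced by the differential on the cokernel of the previous one
    stays injective modulo x_1, ..., x_k. *)
Lemma dual_inj k i : (k <= size x)%N -> (forall l, (l <= k)%N -> dual_exact (i + l)) ->
  forall u : 'cV[R]_(f i.+1), smul_sub _ (take k x) (del i.+1 *m u) ->
  quo_sub (coboundary F i) (take k x) u.
Proof.
elim: k i => [|k IH] i kx ex u.
  rewrite take0 => /smul_nil du; have := ex 0%N isT; rewrite addn0 => /(_ _ du)[e ->].
  by exists 0; [apply: smem0 | exists e; rewrite subr0].
rewrite (take_nth 0) // => /smul_rcons[w sw].
have dd0 : del i.+2 *m (del i.+1 *m u) = 0 by rewrite mulmxA mr_dd mul0mx.
have [s' ss' [e eP]] : quo_sub (coboundary F i.+1) (take k x) w.
  apply: (IH i.+1 (ltnW kx)); first by move=> l lk; rewrite addSnnS; apply: ex.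
  apply: regular_col => //.
  have := smemN (smul_linear (mulmx (del i.+2)) sw).
  by rewrite linearB /= linearZ_LR dd0 sub0r opprK.
have {eP}eP : w = s' + del i.+1 *m e by rewrite -(subrK s' w) eP addrC.
apply/(quo_sub_rcons (coboundary F i) (take k x) x`_k); exists e.
apply: IH; first exact: ltnW.
  by move=> l lk; apply: ex; apply: leqW.
have -> : del i.+1 *m (u - x`_k *: e) = del i.+1 *m u - x`_k *: w + x`_k *: s'.
  by rewrite linearB /= linearZ_LR eP scalerDr opprD addrA addrAC subrK.
by apply: smemD => //; apply: smemZ.
Qed.

(** The sequence x is regular on the cokernel of the transposed differential if
    Ext vanishes in as many consecutive degrees as x has terms. *)
Lemma dual_wreg i : (forall l, (l < size x)%N -> dual_exact (i + l)) ->
  wreg (coboundary F i) x.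
Proof.
move=> ex k kx u [s ss [e eP]]; apply: dual_inj; first exact: ltnW.
  by move=> l lk; apply: ex; apply: leq_ltn_trans kx.
apply: regular_col => //; rewrite scalemxAr -(subrK s (x`_k *: u)) eP.
rewrite /= linearD /= mulmxA mr_dd mul0mx add0r.
exact: (smul_linear (mulmx (del i.+1)) ss).
Qed.

End DualComplex.
End RegularSequences.

(** * The fiber product structure *)

(** I and J are the kernels of the maps from R to the second and to the first
    factor of the fiber product. *)
Lemma fiber_product_ideals (R : comNzRingType) (m : idealr R) (x : seq R) :
  local_ring m -> quasi_fiber_product_ring x ->
  exists I J : submod R^o, let c := smul_sub R^o x in
    [/\ forall a, c a -> I a, forall a, c a -> J a,
        forall a, I a -> J a -> c a,
        forall a, a \in m <-> exists2 y, I y & J (a - y) &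
        (exists2 a, I a & ~ c a) /\ (exists2 a, J a & ~ c a)].
Proof.
move=> Rloc [_ [K KP [S [T [mS [mT [k [p [q [f [_ [resp resq] [sS tT] finj fP]]]]]]]]]]].
pose pi : {rmorphism R -> {ideal_quot K}} := \pi_{ideal_quot K}%qT.
have piP a : pi a = 0 <-> smul_sub R^o x a.
  rewrite -(rmorph0 pi); split=> [/eqP|ca].
    by rewrite -Quotient.idealrBE subr0 => /KP.
  by apply/eqP; rewrite -Quotient.idealrBE subr0; apply/KP.
have pi_surj y : exists a, pi a = y by exists (repr y); apply: reprK.
pose F : {rmorphism R -> S * T} := f \o pi.
have FP st : p st.1 = q st.2 -> exists a, F a = st.
  by move=> /fP[y <-]; have [a <-] := pi_surj y; exists a.
have FE a : p (F a).1 = q (F a).2 by apply/fP; exists (pi a).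
have F0 a : F a = 0 <-> smul_sub R^o x a.
  rewrite -piP; split=> [|pa0]; last by rewrite /F /= pa0 rmorph0.
  by rewrite -(rmorph0 f) => /finj.
have fstM a b : (F (a * b)).1 = (F a).1 * (F b).1 by rewrite rmorphM.
have sndM a b : (F (a * b)).2 = (F a).2 * (F b).2 by rewrite rmorphM.
have fstD a b : (F (a + b)).1 = (F a).1 + (F b).1 by rewrite rmorphD.
have sndD a b : (F (a + b)).2 = (F a).2 + (F b).2 by rewrite rmorphD.
have fstB a b : (F (a - b)).1 = (F a).1 - (F b).1 by rewrite rmorphB.
have fst1 : (F 1).1 = 1 by rewrite rmorph1.
have km a : p (F a).1 = 0 -> a \in m.
  move=> a0; apply: contrapT => /negP /(unit_notin Rloc)[b ba].
  have := fstM b a; rewrite ba fst1 => /(congr1 p).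
  by rewrite rmorphM a0 mulr0 rmorph1 => /eqP; rewrite oner_eq0.
have mk a : a \in m -> p (F a).1 = 0.
  move=> am; apply: contrapT => /eqP a0.
  have [s sE] := resp.1 (p (F a).1)^-1; have [t tE] := resq.1 (p (F a).1)^-1.
  have [|b bE] := FP (s, t); first by rewrite /= sE tE.
  have /km : p (F (b * a - 1)).1 = 0.
    by rewrite fstB fstM fst1 bE rmorphB rmorphM rmorph1 sE mulVf // subrr.
  move=> bam; case/negP: (max1 m); rewrite -(subKr (b * a) 1) rpredB //.
    by apply: idealMr.
have [I IP] : exists I : submod R^o, forall a, I a <-> (F a).2 = 0.
  have I0 : (F 0).2 = 0 by rewrite rmorph0.
  have ID (a : R) (u v : R^o) : (F u).2 = 0 -> (F v).2 = 0 -> (F (a *: u + v)).2 = 0.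
    by move=> u0 v0; rewrite sndD sndM u0 v0 mulr0 addr0.
  by exists (Submod (V := R^o) I0 ID).
have [J JP] : exists J : submod R^o, forall a, J a <-> (F a).1 = 0.
  have J0 : (F 0).1 = 0 by rewrite rmorph0.
  have JD (a : R) (u v : R^o) : (F u).1 = 0 -> (F v).1 = 0 -> (F (a *: u + v)).1 = 0.
    by move=> u0 v0; rewrite fstD fstM u0 v0 mulr0 addr0.
  by exists (Submod (V := R^o) J0 JD).
exists I, J; split.
- by move=> a /F0 a0; apply/IP; rewrite a0.
- by move=> a /F0 a0; apply/JP; rewrite a0.
- move=> a /IP a2 /JP a1; apply/F0.
  by rewrite [F a]surjective_pairing a1 a2.
- move=> a; split=> [/mk a0|[y /IP y2 /JP y1]].
    have [|y yE] := FP ((F a).1, 0); first by rewrite /= a0 rmorph0.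
    exists y; first by apply/IP; rewrite yE.
    by apply/JP; rewrite fstB yE subrr.
  apply: km; have := fstD y (a - y); rewrite y1 addr0 [y + _]addrC subrK => ->.
  by rewrite FE y2 rmorph0.
split.
- have [s sm s0] := sS; have [|a aE] := FP (s, 0).
    by rewrite rmorph0; apply/(resp.2 s).
  exists a; first by apply/IP; rewrite aE.
  by move=> /F0; rewrite aE => -[s0']; rewrite s0' eqxx in s0.
- have [s sm s0] := tT; have [|a aE] := FP (0, s).
    by rewrite rmorph0; apply/esym/(resq.2 s).
  exists a; first by apply/JP; rewrite aE.
  by move=> /F0; rewrite aE => -[s0']; rewrite s0' eqxx in s0.
Qed.
(** * Either M or N has finite projective dimension *)

Section Dichotomy.
Variables (R : comNzRingType) (b : nat -> nat) (d : forall i, 'M[R]_(b i.+1, b i)).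
Hypothesis dd : forall i, d i.+1 *m d i = 0.

(** Dimension shifting along 0 -> P / Q -> V / Q -> V' / Q' -> V' / W' -> 0,
    where P is the preimage of Q' and W' = phi(V) + Q'. *)
Lemma tor_van_second_syzygy (V V' : lmodType R) (phi : {linear V -> V'})
    (Q : submod V) (Q' : submod V') j :
  (forall v, Q v -> Q' (phi v)) ->
  tor_van d (full_sub V) Q j -> tor_van d (full_sub V') Q' j.+1 ->
  tor_van d (full_sub V') (sum_sub Q' (im_sub phi)) j.+2 ->
  tor_van d (preim_sub phi Q') Q j.
Proof.
move=> QQ' T0 T1 T2 v Pv Qv.
have [//|//|w _ wP] := T0 v.
have [//|l|z _ zP] := T1 (phi \o w).
  rewrite -linear_vmul -[vmul w _ _](subrK (v l)) linearD /=.
  apply: smemD; last exact: Pv.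
  by rewrite -opprB linearN; apply/smemN/QQ'.
have [//|l|y _ yP] := T2 z.
  exists (- (phi (w l) - vmul z (d j.+2) l)); first exact/smemN/zP.
  by exists (w l); rewrite opprK addrC subrK.
pose z' k := z k - vmul y (d j.+3) k.
have /choice[a aP] : forall k, exists a, Q' (z' k - phi a).
  by move=> k; have [u Qu [a aE]] := yP k; exists a; rewrite -aE opprB addrC subrK.
exists (fun k => w k - vmul a (d j.+2) k) => k.
  rewrite /= linearB linear_vmul.
  have -> : phi (w k) - vmul (phi \o a) (d j.+2) k =
    (phi (w k) - vmul z (d j.+2) k) + vmul (fun l => z' l - phi (a l)) (d j.+2) k.
    rewrite vmulB /z' vmulB vmul_mul dd vmul0 subr0 addrA subrK.
    by congr (_ - _); apply: eq_vmul.
  by apply: smemD; [exact: zP | exact: smem_vmul].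
by rewrite vmulB vmul_mul dd vmul0 subr0.
Qed.

End Dichotomy.

Section MainDichotomy.
Variables (R : comNzRingType) (m : idealr R).
Hypothesis Rloc : local_ring m.
Variables (M N : lmodType R) (F : minres m M) (G : minres m N).

Lemma tor_van_free_col q j : tor_van (mr_mat G) (full_sub 'cV[R]_q) (zero_sub _) j.
Proof.
move=> v _ dv; have [|D DP] := @mr_exact_mx _ _ _ G j _ (cols v).
  apply/matrixP => i l; have := dv l; rewrite vmul_cols => /colP/(_ i).
  by rewrite !mxE.
exists (fun k => col k D) => // k; rewrite vmul_cols /=.
rewrite -{1}[v k]col_cols DP; apply/eqP; rewrite subr_eq0; apply/eqP.
by congr (col k (_ *m _)); apply/matrixP => i l; rewrite !mxE.
Qed.

Lemma tor_van_free j : tor_van (mr_mat G) (full_sub R^o) (zero_sub _) j.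
Proof.
move=> v _ dv; have [|D DP] := (@mr_kerS _ _ _ G j (\row_k v k)).1.
  by apply/rowP => l; rewrite -vmul_row dv mxE.
exists (fun k => D 0 k) => // k; rewrite vmul_row /=.
have /rowP/(_ k) := DP; rewrite mxE => ->; apply/eqP; rewrite subr_eq0; apply/eqP.
by congr ((_ *m _) 0 k); apply/rowP => l; rewrite mxE.
Qed.

(** The columns with all entries in K. *)
Definition col_sub (K : submod R^o) q : submod 'cV[R]_q.
Proof.
exists (fun v : 'cV[R]_q => forall i, K (v i 0)); first by move=> i; rewrite mxE; apply: smem0.
by move=> a u v Ku Kv i; rewrite !mxE; apply: (smemP a (Ku i) (Kv i)).
Defined.

Variables (x : seq R) (t : nat).
Hypothesis xqfp : quasi_fiber_product_ring x.
Hypotheses (N_nz : nonzero_module N) (N_rigid : Tor_rigid N).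
Hypothesis Ext_van : forall i, (t <= i <= t + size x)%N -> Ext_zero i.+1 M N.

(** Finite projective dimension of N is stated as boundedness of its minimal
    resolution. *)
Theorem rigid_dichotomy : finite_pd M \/ exists n, forall i, (n <= i)%N -> mr_rk G i = 0%N.
Proof.
have [[xreg _] _] := xqfp.
have [I [J [cI cJ IJc mIJ [Ic Jc]]]] := fiber_product_ideals Rloc xqfp.
set c := smul_sub R^o x in cI cJ IJc mIJ Ic Jc *.
have cm a : c a -> a \in m.
  by move=> ca; apply/mIJ; exists 0; [apply: smem0 | rewrite subr0; apply: cJ].
have xm a : a \in x -> a \in m.
  by move=> ax; apply: cm; rewrite -[a]mulr1; apply: (smul_gen (1 : R^o) ax).
have TE i : (t <= i <= t + size x)%N ->
    forall j, tor_van (mr_mat G) (full_sub _) (coboundary F i.+1) j.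
  move=> ti j.
  by apply: (rigid_tor_van N_rigid (ext_tor1 (F := F) (G := G) (Ext_van ti)) (leq0n j)).
have ex i : (t <= i <= t + size x)%N -> dual_exact F i.
  by move=> ti; apply: (ext_exact Rloc (Ext_van ti) N_nz (TE i ti 1%N)).
have creg0 : wreg (coboundary F t) x.
  by apply: dual_wreg => // l lx; apply: ex; lia.
have creg1 : wreg (coboundary F t.+1) x.
  by apply: dual_wreg => // l lx; apply: ex; lia.
have inj (u : 'cV_(mr_rk F t.+1)) : smul_sub _ x (mr_mat F t.+1 *m u) ->
    quo_sub (coboundary F t) x u.
  rewrite -{1 2}(take_size x); apply: dual_inj => // l lx; apply: ex; lia.
pose phi : {linear 'cV[R]_(mr_rk F t.+1) -> 'cV[R]_(mr_rk F t.+2)} := mulmx (mr_mat F t.+1).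
pose Q := smul_sub 'cV[R]_(mr_rk F t.+1) x.
pose P := preim_sub phi (smul_sub _ x).
have QP v : Q v -> P v by apply: smul_linear.
have [PQ|nPQ] := pselect (exists2 v, P v & ~ Q v); last first.
  left; apply: (mr_finite_pd (F := F) (n := t)); apply: mr_stop.
  have BQ v : coboundary F t v -> Q v.
    case=> u ->; apply: contrapT => nQ; apply: nPQ; exists (mr_mat F t *m u) => //.
    change (smul_sub 'cV[R]_(mr_rk F t.+2) x (mr_mat F t.+1 *m (mr_mat F t *m u))).
    by rewrite mulmxA mr_dd mul0mx; apply: smem0.
  have B0 : forall v, coboundary F t v -> zero_sub _ v.
    have [|s sP] := sub_fg_full Rloc (@span_delta_col _ _)
      (P := coboundary F t) (Q := zero_sub _).
      by move=> _ ->; apply: smem0.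
    apply: (nakayama Rloc sP) => w Bw.
    have [e [Be ->]] := wreg_inter creg0 Bw (BQ w Bw).
    exists (size x), (fun i => x`_i), (fun i => e i); split=> //.
      by move=> i; apply/xm/mem_nth.
    by rewrite /= subrr.
  apply/matrixP => i k; have : coboundary F t (col k (mr_mat F t)).
    by exists (delta_mx k 0); rewrite colE.
  by move=> /B0 /colP /(_ i); rewrite !mxE.
right; exists (size x).+2.
have coordm v : P v -> forall i, v i 0 \in m.
  move=> /inj[s /smul_col sQ [e eP]] i; rewrite -(subrK s v) eP /= mxE.
  apply: rpredD; last exact: cm.
  by rewrite mxE rpred_sum // => k _; rewrite mulrC; apply: idealMr; apply: mr_min.
pose P1 := cap_sub P (col_sub I _); pose P2 := cap_sub P (col_sub J _).
have phi_co (K : submod R^o) v : col_sub K _ v -> col_sub K _ (phi v).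
  by move=> Kv i; rewrite /= mxE; apply: smem_sum => k _; apply: smemZ.
have PE v : P v <-> forall i, c (phi v i 0) by apply: smul_col.
have QE v : Q v <-> forall i, c (v i 0) by apply: smul_col.
have Tcol q i : (size x <= i)%N ->
    tor_van (mr_mat G) (full_sub 'cV[R]_q) (smul_sub _ x) i.
  move=> xi; apply: (tor_van_ext (P := full_sub _) (Q := quo_sub (zero_sub _) x)) => //.
    by move=> v; apply: quo_sub0.
  apply: (tor_van_quo (@mr_dd _ _ _ G) (wreg_col xreg (q := q)) (j0 := 0)) => // j _.
  exact: tor_van_free_col.
apply: (decomposable_bounded Rloc (@mr_dd _ _ _ G) (@mr_min _ _ _ G) cI cJ IJc mIJ Ic Jc
  (@span_delta_col _ _) (P1 := P1) (P2 := P2) (P := P) (Q := Q)).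
- by move=> v [].
- by move=> v [].
- by move=> v Qv; split; [apply: QP | move=> i; apply: cI; apply: (QE v).1].
- by move=> v Qv; split; [apply: QP | move=> i; apply: cJ; apply: (QE v).1].
- move=> v Pv; have /choice[a aP] : forall i, exists a, I a /\ J (v i 0 - a).
    by move=> i; have /mIJ[a Ia Ja] := coordm v Pv i; exists a.
  pose u : 'cV[R]_(mr_rk F t.+1) := \col_i a i.
  have Iu : col_sub I _ u by move=> i; rewrite mxE; case: (aP i).
  have Jvu : col_sub J _ (v - u) by move=> i; rewrite !mxE; case: (aP i).
  have Pu : P u.
    apply/PE => i; apply: IJc; first exact: phi_co.
    have -> : phi u i 0 = phi v i 0 - phi (v - u) i 0.
      by rewrite linearB /= !mxE opprB addrC subrK.
    apply: (smemB (P := J)); first exact: cJ ((PE v).1 Pv i).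
    exact: phi_co.
  by exists u => //; split=> //; apply: smemB.
- move=> v [_ Iv] [_ Jv]; apply/QE => i; exact: IJc.
- move=> a v Ja [_ Iv]; apply/QE => i; rewrite mxE; apply: IJc.
    exact: (smemZ (P := I) a (Iv i)).
  by rewrite mulrC; apply: (smemZ _ Ja).
- move=> a v Ia [_ Jv]; apply/QE => i; rewrite mxE; apply: IJc.
    by rewrite mulrC; apply: (smemZ _ Ia).
  exact: (smemZ (P := J) a (Jv i)).
- exact: PQ.
- move=> i xi; apply: (tor_van_ext (P := full_sub R^o) (Q := quo_sub (zero_sub R^o) x)) => //.
    by move=> v; apply: quo_sub0.
  apply: (tor_van_quo (@mr_dd _ _ _ G) (wreg_ring xreg) (j0 := 0)) => // j _.
  exact: tor_van_free.
- move=> i xi.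
  apply: (tor_van_second_syzygy (@mr_dd _ _ _ G) (phi := phi) (Q' := smul_sub _ x)) => //.
  + exact: Tcol.
  + by apply: Tcol; apply: leqW.
  + apply: (tor_van_quo (@mr_dd _ _ _ G) creg1 (j0 := 0) _ (leqW (leqW xi))) => j _.
    by apply: TE; lia.
Qed.

End MainDichotomy.
(** * Regular sequences and chains of primes *)

Section PrimeChains.
Variables (R : comNzRingType) (m : idealr R).
Hypothesis Rloc : local_ring m.

(** Prime ideals given by arbitrary propositions. *)
Definition prime_sub (P : submod R^o) : Prop :=
  ~ P (1 : R) /\ forall a b : R, P (a * b) -> P a \/ P b.

Lemma pack_prime (P : submod R^o) : prime_sub P ->
  exists Q : prime_idealr R, forall a, a \in Q <-> P a.
Proof.
move=> [P1 PM]; have [J JP] := pack_ideal P1.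
have Jprime : prime_idealr_closed J.
  move=> a b /JP /PM[] ?; apply/orP; [left | right]; exact/JP.
pose Q : prime_idealr R := HB.pack (J : R -> bool) (Idealr.on J)
  (isPrimeIdealrClosed.Build R J Jprime).
by exists Q.
Qed.

Lemma max_prime : prime_sub (ideal_sub m).
Proof.
split=> [|a b abm]; first by move=> /=; rewrite idealr1.
have [am|/(unit_notin Rloc)[a' aa]] := boolP (a \in m); first by left.
by right; rewrite /= -[b]mul1r -aa -mulrA; apply: idealMr.
Qed.

(** Below a prime containing c and an element regular modulo c there is a
    smaller prime containing c: take an ideal maximal among those that avoid
    the products of powers of y with elements outside P. *)
Lemma prime_below (P c : submod R^o) (y : R) :
  prime_sub P -> (forall a, c a -> P a) -> (forall a : R, c (y * a) -> c a) ->
  exists Q, [/\ prime_sub Q, forall a, c a -> Q a, forall a, Q a -> P a & ~ Q y].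
Proof.
move=> [P1 PM] cP yreg.
pose Phi (K : submod R^o) := (forall a, c a -> K a) /\
  forall (s : R) k, ~ P s -> ~ K (s * y ^+ k).
have cPhi : Phi c.
  split=> // s k Ps; elim: k => [|k IH] cs; first by apply/Ps/cP; rewrite mulr1 in cs.
  by apply: IH; apply: yreg; rewrite mulrCA -exprS.
have [Q [[cQ avoid] _] Qmax] := noeth_max (local_noeth Rloc) cPhi.
exists Q; split=> //; last first.
- by move=> Qy; apply: (avoid 1 1%N P1); rewrite mul1r expr1.
- by move=> a Qa; apply: contrapT => Pa; apply: (avoid a 0%N Pa); rewrite mulr1.
split=> [Q1|a b Qab]; first by apply: (avoid 1 0%N P1); rewrite mulr1.
(* Enlarging Q by an element makes it meet the multiplicative set. *)
have meet (a0 : R) : ~ Q a0 -> exists (s : R) k (r : R), ~ P s /\ Q (s * y ^+ k - r * a0).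
  move=> Qa0; apply: contrapT => no; apply: Qa0.
  apply: (Qmax (adjoin Q (a0 : R^o))); last 1 first.
  - by exists 1; rewrite scale1r subrr; apply: smem0.
  - split=> [e ce|s k Ps [r Qr]]; last by apply: no; exists s, k, r.
    by exists 0; rewrite scale0r subr0; apply: cQ.
  - by move=> e Qe; exists 0; rewrite scale0r subr0.
have [Qa|/meet[s [k [r [Ps Qs]]]]] := pselect (Q a); first by left.
have [Qb|/meet[s' [k' [r' [Ps' Qs']]]]] := pselect (Q b); first by right.
case: (avoid (s * s') (k + k')%N); first by case/PM.
have -> : s * s' * y ^+ (k + k') =
  s' * y ^+ k' * (s * y ^+ k - r * a) + (r * a * (s' * y ^+ k' - r' * b) + r * r' * (a * b)).
  by rewrite exprD; ring.
apply: (smemD (P := Q)); first exact: (smemZ (P := Q) (s' * y ^+ k') Qs).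
apply: (smemD (P := Q)); first exact: (smemZ (P := Q) (r * a) Qs').
exact: (smemZ (P := Q) (r * r') Qab).
Qed.

(** The primes are found from the top down, the i-th one containing the first i
    terms of the sequence but, for i less than its length, not the next one. *)
Lemma regular_prime_chain (z : seq R) :
  {subset z <= m} -> regular_seq (R^o : lmodType R) z -> prime_chain R (size z).
Proof.
move=> zm [zreg _].
suff H i : (i <= size z)%N -> forall P : submod R^o, prime_sub P ->
    (forall a, smul_sub R^o (take i z) a -> P a) ->
    exists Q : nat -> prime_idealr R, (forall a, a \in Q i <-> P a) /\
      forall k, (k < i)%N -> {subset Q k <= Q k.+1} /\ ~ {subset Q k.+1 <= Q k}.
  have [|Q [_ QP]] := H (size z) (leqnn _) _ max_prime; last by exists Q.
  rewrite take_size => a [c ->]; apply: (smem_sum (P := ideal_sub m)) => k _ /=.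
  by rewrite [_ *: _]mulrC; apply/idealMr/zm/mem_nth.
elim: i => [|i IH] iz P Pprime zP.
  by have [Q QP] := pack_prime Pprime; exists (fun=> Q).
have [||P' [P'prime zP' P'P nP'y]] := @prime_below P (smul_sub R^o (take i z)) z`_i Pprime.
- move=> a sa; apply: zP; rewrite (take_nth 0) //; apply/smul_rcons.
  by exists 0; rewrite scaler0 subr0.
- by move=> a; apply: zreg.
have [Q [Qi Qch]] := IH (ltnW iz) P' P'prime zP'.
have [Q' Q'P] := pack_prime Pprime.
exists (fun k => if (k <= i)%N then Q k else Q'); rewrite ltnn; split=> // k ki.
rewrite -ltnS ki; case: (ltngtP k i) => [ki'|ki'|->].
- exact: Qch.
- by rewrite ltnS leqNgt ki' in ki.
split=> [a /Qi /P'P /Q'P //|sub]; apply/nP'y/Qi/sub/Q'P/zP.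
by rewrite -[z`_i]mulr1; apply: (smul_gen (1 : R^o)); rewrite (take_nth 0) // mem_rcons inE eqxx.
Qed.

(** * Depth zero and socles *)

(** The ideal (c : a). *)
Definition colon_sub (c : submod R^o) (a : R) : submod R^o.
Proof.
exists (fun r : R^o => c (r * a : R)); first by rewrite mul0r; apply: smem0.
move=> b u v cu cv; rewrite mulrDl -mulrA; apply: smemD => //.
exact: (smemZ (P := c) b cu).
Defined.

(** If every element of m is a zero divisor modulo c, then some a outside c
    satisfies m a <= c. *)
Lemma socle_or_regular (c : submod R^o) :
  (exists2 a : R, ~ c a & forall r, r \in m -> c (r * a : R)) \/
  exists2 w, w \in m & forall u : R, c (w * u : R) -> c u.
Proof.
apply: contrapT => /not_orP[nosoc noreg].
pose good (a : R) := ~ c a /\ forall b : R, ~ c b ->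
  (forall r : R, c (r * a : R) -> c (r * b : R)) -> forall r : R, c (r * b : R) -> c (r * a : R).
have good_prime a r r' : good a -> c (r * r' * a : R) -> c (r * a : R) \/ c (r' * a : R).
  move=> [ca amax] crr; have [|cr'] := pselect (c (r' * a : R)); [by right | left].
  apply: (amax (r' * a)) => //; last by rewrite mulrA.
  by move=> s csa; rewrite mulrCA; apply: (smemZ (P := c) r' csa).
have good_ex (b : R) : ~ c b ->
    exists2 a, good a & forall r : R, c (r * b : R) -> c (r * a : R).
  move=> cb; pose Phi (K : submod R^o) := exists2 a : R, ~ c a & forall r, K r <-> c (r * a : R).
  have [|K [[a ca Ka] bK] Kmax] := noeth_max (local_noeth Rloc) (Phi := Phi) (I := colon_sub c b).
    by exists b.
  exists a; last by move=> r /bK /Ka.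
  split=> // e ce ae r cre; apply/Ka; apply: (Kmax (colon_sub c e)) => //; first by exists e.
  by move=> r' /Ka /ae.
(* Noetherian induction on K: enlarge the list s of elements with maximal
   annihilators, and keep an element w outside all these annihilators. *)
suff H (K : submod R^o) : forall (s : seq R^o) (w : R), (forall v, K v <-> span c s v) ->
    (forall a, a \in s -> good a) -> w \in m -> (forall a, a \in s -> ~ c (w * a : R)) -> False.
  by apply: (H c [::] 0) => //; apply: idealr0.
elim/(noeth_ind (local_noeth Rloc)): K => K IH s w KE sgood wm ws.
have [u cu cwu] : exists2 u : R, ~ c u & c (w * u : R).
  apply: contrapT => no; apply: noreg; exists w => // u cwu; apply: contrapT => cu.
  by apply: no; exists u.
have [a' ga' uaa'] := good_ex u cu.
have cwa' := uaa' _ cwu.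
have [sg sgs sga'] : exists2 sg : R, (forall a, a \in s -> c (sg * a : R)) & ~ c (sg * a' : R).
  elim: (s) sgood ws => [|a r IHr] rgood rw; first by exists 1; rewrite // mul1r; case: ga'.
  have [||sg sgr sga'] := IHr.
  - by move=> e er; apply: rgood; rewrite inE er orbT.
  - by move=> e er; apply: rw; rewrite inE er orbT.
  have [s1 cs1a cs1a'] : exists2 s1 : R, c (s1 * a : R) & ~ c (s1 * a' : R).
    apply: contrapT => no; apply: (rw a); first by rewrite inE eqxx.
    have [|_ amax] := rgood a; first by rewrite inE eqxx.
    apply: (amax a') => //; first by case: ga'.
    by move=> q cqa; apply: contrapT => cqa'; apply: no; exists q.
  exists (s1 * sg); last by case/(good_prime _ _ _ ga').
  move=> e; rewrite inE => /orP[/eqP ->|/sgr cse].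
    by rewrite mulrAC mulrC; apply: (smemZ (P := c) sg cs1a).
  by rewrite -mulrA; apply: (smemZ (P := c) s1 cse).
have [g gm cga'] : exists2 g, g \in m & ~ c (g * a' : R).
  apply: contrapT => no; apply: nosoc; exists a'; first by case: ga'.
  by move=> r rm; apply: contrapT => cra; apply: no; exists r.
have cgsa' : ~ c (g * sg * a' : R) by case/(good_prime _ _ _ ga').
apply: (IH (span c ((a' : R^o) :: s)) _ _ (a' :: s) (w + g * sg)) => //.
- by move=> v /KE sv; exists 0; rewrite scale0r subr0.
- exists (a' : R^o); first by apply: span_gen; rewrite inE eqxx.
  move=> /KE sa'; apply: sga'; rewrite mulrC.
  apply: (span_sub (P := colon_sub c sg) _ _ sa') => [v cv|v vs] /=.
    by rewrite mulrC; apply: (smemZ (P := c) sg cv).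
  by rewrite mulrC; apply: sgs.
- by move=> a; rewrite inE => /orP[/eqP ->|/sgood].
- by apply: rpredD => //; rewrite mulrC; apply: idealMr.
move=> a; rewrite inE => /orP[/eqP ->|as_].
  rewrite mulrDl => h; apply: cgsa'.
  by have := smemB (P := c) h cwa'; rewrite addrC addrA addNr add0r.
rewrite mulrDl => h; apply: (ws a as_).
have cga : c (g * sg * a : R).
  by rewrite -mulrA; apply: (smemZ (P := c) g (sgs a as_)).
by have := smemB (P := c) h cga; rewrite addrK.
Qed.

End PrimeChains.
(** * Modules of finite projective dimension and maximal depth *)

Section FiniteResolutions.
Variables (R : comNzRingType) (m : idealr R).

(** The quotient of V by W has a minimal free resolution whose last nonzero
    term is in degree L. *)
Definition res_length (V : lmodType R) (W : submod V) (L : nat) : Prop :=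
  exists (b : nat -> nat) (d : forall i, 'M[R]_(b i.+1, b i)) (g : 'I_(b 0) -> V),
    [/\ (forall i, d i.+1 *m d i = 0) /\
          (forall i (c : 'rV[R]_(b i.+1)), c *m d i = 0 -> exists e, c = e *m d i.+1),
        forall i k l, d i k l \in m,
        (forall v, exists c, W (v - comb g c)) /\
          (forall c, W (comb g c) <-> exists e, c = e *m d 0),
        b L <> 0%N &
        forall i, (L < i)%N -> b i = 0%N].

Lemma minres_length (V : lmodType R) (F : minres m V) L :
  mr_rk F L <> 0%N -> (forall i, (L < i)%N -> mr_rk F i = 0%N) ->
  res_length (zero_sub V) L.
Proof.
move=> FL Fi; exists (mr_rk F), (mr_mat F), (mr_gen F); split=> //.
- by split; [apply: mr_dd | move=> i c /mr_kerS].
- exact: mr_min.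
split=> [v|c]; last exact: mr_ker0.
by have [c ->] := mr_surj F v; exists c; rewrite /= subrr.
Qed.

Section Cone.
Variables (b : nat -> nat) (d : forall i, 'M[R]_(b i.+1, b i)) (y : R).

(** The mapping cone of multiplication by y. *)
Definition cone_rk (i : nat) : nat := if i is i'.+1 then (b i'.+1 + b i')%N else b 0.

Definition cone_mat (i : nat) : 'M[R]_(cone_rk i.+1, cone_rk i) :=
  match i return 'M[R]_(cone_rk i.+1, cone_rk i) with
  | 0 => col_mx (d 0) y%:M
  | i'.+1 => block_mx (d i'.+1) 0 y%:M (- d i')
  end.

Lemma cone_mat0 (c : 'rV[R]_(b 1)) (e : 'rV[R]_(b 0)) :
  row_mx c e *m cone_mat 0 = c *m d 0 + y *: e.
Proof. by rewrite /= mul_row_col mul_mx_scalar. Qed.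

Lemma cone_matS i (c : 'rV[R]_(b i.+2)) (e : 'rV[R]_(b i.+1)) :
  row_mx c e *m cone_mat i.+1 = row_mx (c *m d i.+1 + y *: e) (- (e *m d i)).
Proof. by rewrite /= mul_row_block mul_mx_scalar mulmx0 add0r mulmxN. Qed.

Hypothesis dd : forall i, d i.+1 *m d i = 0.
Hypothesis d_exact : forall i (c : 'rV[R]_(b i.+1)), c *m d i = 0 ->
  exists e, c = e *m d i.+1.
Hypothesis y_reg : forall c : 'rV[R]_(b 0), (exists e, y *: c = e *m d 0) ->
  exists e, c = e *m d 0.

Lemma cone_dd i : cone_mat i.+1 *m cone_mat i = 0.
Proof.
case: i => [|i] /=.
  rewrite mul_block_col dd mul0mx addr0 mul_scalar_mx mul_mx_scalar scalerN.
  by rewrite [y *: _ + _]addrC addNr col_mx0.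
rewrite mulmx_block !mulNmx !mulmxN opprK !dd !mul0mx !mulmx0 oppr0 !addr0.
by rewrite mul_scalar_mx mul_mx_scalar subrr block_mx0.
Qed.

Lemma cone_exact i (c : 'rV[R]_(cone_rk i.+1)) : c *m cone_mat i = 0 ->
  exists e, c = e *m cone_mat i.+1.
Proof.
case: i c => [|i] c; rewrite -[c]hsubmxK; set p := lsubmx c; set q := rsubmx c.
  rewrite cone_mat0 => /eqP; rewrite addr_eq0 => /eqP pq.
  have [|e qE] := y_reg (c := q); first by exists (- p); rewrite mulNmx pq opprK.
  have [|g gE] := d_exact (i := 0) (c := p + y *: e).
    by rewrite mulmxDl pq qE -scalemxAl addNr.
  exists (row_mx g (- e)); rewrite cone_matS -gE mulNmx opprK -qE.
  by rewrite scalerN addrK.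
rewrite cone_matS => /eqP; rewrite row_mx_eq0 oppr_eq0 => /andP[].
rewrite addr_eq0 => /eqP pq /eqP qd.
have [e qE] := d_exact qd.
have [|g gE] := d_exact (i := i.+1) (c := p + y *: e).
  by rewrite mulmxDl pq qE -scalemxAl addNr.
exists (row_mx g (- e)); rewrite cone_matS -gE mulNmx opprK -qE.
by rewrite scalerN addrK.
Qed.

Lemma cone_min i k l : y \in m -> (forall i k l, d i k l \in m) -> cone_mat i k l \in m.
Proof.
move=> ym dm; have sm n (k' l' : 'I_n) : (y%:M : 'M[R]_n) k' l' \in m.
  by rewrite mxE; case: eqP => _; rewrite ?mulr1n // mulr0n idealr0.
case: i k l => [|i] k l /=; rewrite !mxE; first by case: split.
case: split => k'; rewrite mxE; case: split => l' //.
  by rewrite mxE idealr0.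
by rewrite mxE; have := dm i k' l'; rewrite -rpredN.
Qed.

End Cone.

Lemma res_length_mod (V : lmodType R) (W W' : submod V) (y : R) L :
  y \in m -> (forall v, W (y *: v) -> W v) ->
  (forall v, W' v <-> exists u, W (v - y *: u)) ->
  res_length W L -> res_length W' L.+1.
Proof.
move=> ym yreg W'P [b [d [g [[dd d_exact] dm [gs gk] bL bz]]]].
have y_reg (c : 'rV[R]_(b 0)) : (exists e, y *: c = e *m d 0) -> exists e, c = e *m d 0.
  by move=> /gk; rewrite linearZ_LR => /yreg /gk.
exists (cone_rk b), (cone_mat d y), g; split.
- by split; [apply: cone_dd | apply: cone_exact].
- by move=> i k l; apply: cone_min.
- split=> [v|c].
    have [c Wc] := gs v; exists c; apply/W'P; exists 0.
    by rewrite scaler0 subr0.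
  rewrite W'P; split=> [[u Wu]|[e]].
    have [e We] := gs u; have /gk[a aE] : W (comb g (c - y *: e)).
      rewrite linearB linearZ_LR /=.
      have -> : comb g c - y *: comb g e = (comb g c - y *: u) + y *: (u - comb g e).
        by rewrite scalerBr addrA subrK.
      by apply: smemD => //; apply: smemZ.
    by exists (row_mx a e); rewrite cone_mat0 -aE subrK.
  rewrite -[e]hsubmxK cone_mat0 => ->; exists (comb g (rsubmx e)).
  by rewrite linearD linearZ_LR /= addrK; apply/gk; eexists.
- by rewrite /= => /eqP; rewrite addn_eq0 => /andP[_ /eqP].
- by case=> // i iL; rewrite /= !bz // ltnW.
Qed.

Lemma res_length_quo (V : lmodType R) (W : submod V) (s : seq R) L :
  {subset s <= m} -> wreg W s -> res_length W L ->
  res_length (quo_sub W s) (L + size s).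
Proof.
move=> sm sreg WL.
suff H k : (k <= size s)%N -> res_length (quo_sub W (take k s)) (L + k).
  by have := H (size s) (leqnn _); rewrite take_size.
elim: k => [|k IH] ks.
  rewrite addn0 take0; case: WL => b [d [g [dP dm [gs gk] bL bz]]].
  have W0 v : quo_sub W [::] v <-> W v.
    split=> [[u /smul_nil ->]|Wv]; first by rewrite subr0.
    by exists 0; [exact: smem0 | rewrite subr0].
  exists b, d, g; split=> //; split=> [v|c]; last by rewrite W0.
  by have [c cP] := gs v; exists c; apply/W0.
rewrite addnS; apply: (res_length_mod (y := s`_k) (W := quo_sub W (take k s))).
- exact/sm/mem_nth.
- exact: sreg.
- by move=> v; rewrite (take_nth 0) //; apply: quo_sub_rcons.
- exact: IH (ltnW ks).
Qed.

Hypothesis Rloc : local_ring m.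

(** A finite projective dimension is at most the Krull dimension.  Let z be an
    R-regular sequence in m of maximal length k, so that m a is contained in (z)
    for some a outside (z).  If k < L, then the resolution modulo z is exact in
    degree L; but by minimality a times a basis element is a cycle there. *)
Lemma res_length_dim (V : lmodType R) (W : submod V) L e :
  res_length W L -> has_krull_dim R e -> (L <= e)%N.
Proof.
move=> [b [d [g [[dd d_exact] dm _ bL bz]]]] [_ dimR].
pose reg k := exists z : seq R,
  [/\ size z = k, {subset z <= m} & regular_seq (R^o : lmodType R) z].
have smul_m (z : seq R) a : {subset z <= m} -> smul_sub R^o z a -> a \in m.
  move=> zm [c ->]; apply: (smem_sum (P := ideal_sub m)) => k _ /=.
  by rewrite [_ *: _]mulrC; apply/idealMr/zm/mem_nth.
have reg0 : exists k, `[< reg k >].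
  exists 0%N; apply/asboolP; exists [::]; split=> //; split=> //.
  by exists (1 : R); case=> c; rewrite big_ord0 => /eqP; rewrite oner_eq0.
have reg_le k : `[< reg k >] -> (k <= e)%N.
  by move=> /asboolP[z [<- zm zreg]]; apply/dimR/(regular_prime_chain Rloc).
case: (ex_maxnP reg0 reg_le) => k kreg kmax.
have ke := reg_le k kreg; move/asboolP: kreg => [z [zk zm zreg]].
apply: leq_trans ke; rewrite leqNgt; apply/negP => kL.
have [[a ca ma]|[w wm wreg]] := socle_or_regular Rloc (smul_sub R^o z); last first.
  suff /asboolP/kmax : reg k.+1 by rewrite ltnn.
  exists (rcons z w); rewrite size_rcons zk.
  have zwm : {subset rcons z w <= m}.
    by move=> r; rewrite mem_rcons inE => /orP[/eqP ->|/zm].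
  split=> //; split=> [i|]; last first.
    by exists (1 : R) => /(smul_m _ _ zwm); rewrite idealr1.
  rewrite size_rcons ltnS leq_eqVlt => /orP[/eqP ->|iz] v.
    by rewrite -cats1 take_size_cat // nth_cat ltnn subnn; apply: wreg.
  rewrite nth_rcons iz -cats1 takel_cat ?(ltnW iz) //; exact: zreg.1.
case: L => [//|L] in bL bz kL *.
have T : tor_van d (full_sub R^o) (smul_sub R^o z) L.
  apply: (tor_van_ext (P := full_sub _) (Q := quo_sub (zero_sub R^o) z)) => //.
    by move=> v; apply: quo_sub0.
  apply: (tor_van_quo dd (wreg_ring zreg.1) (j0 := 0)); last by rewrite zk.
  move=> j _ v _ dv; have [|D DP] := d_exact j (\row_k v k).
    by apply/rowP => l; rewrite -vmul_row dv mxE.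
  exists (fun k => D 0 k) => // i; rewrite vmul_row /=.
  have /rowP/(_ i) := DP; rewrite mxE => ->; apply/eqP; rewrite subr_eq0; apply/eqP.
  by congr ((_ *m _) 0 i); apply/rowP => l; rewrite mxE.
have [//|l|v _ vP] := T (fun=> a).
  by apply: smem_sum => i _; apply: ma.
have [o _] : exists o : 'I_(b L.+1), True.
  by case: (b L.+1) bL => [//|q] _; exists ord0.
apply: ca; have := vP o; rewrite /vmul big1 ?subr0 // => i.
by have := ltn_ord i; rewrite [X in (_ < X)%N -> _]bz.
Qed.

Lemma finite_res_MCM_free (N : lmodType R) (G : minres m N) n :
  (forall i, (n <= i)%N -> mr_rk G i = 0%N) -> maximal_CM m N -> free_module N.
Proof.
move=> Gn [_ [e [[[s [se sm [sreg _]]] _] dimR]]].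
have [G1|G1] := eqVneq (mr_rk G 1) 0%N; first exact: (mr_free G1).
have bound i : mr_rk G i != 0%N -> (i <= n)%N.
  by rewrite leqNgt => Gi; apply: contra Gi => /ltnW/Gn ->.
have ex1 : exists i, mr_rk G i != 0%N by exists 1%N.
case: (ex_maxnP ex1 bound) => p Gp pmax.
have GL : res_length (zero_sub N) p.
  apply: (@minres_length _ G); first exact/eqP.
  move=> i pi; apply/eqP; apply: contraTT pi => Gi.
  by rewrite -leqNgt; apply: pmax.
have swreg : wreg (zero_sub N) s.
  by move=> k ks u /quo_sub0 H; apply/quo_sub0/sreg.
have := res_length_dim (res_length_quo sm swreg GL) dimR.
by rewrite se -{2}[e]add0n leq_add2r leqNgt pmax.
Qed.

End FiniteResolutions.

Theorem theorem3p20 (R : comNzRingType) (m : idealr R) (n : nat)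
    (x : n.-tuple R) (M N : lmodType R)
    (R_local : local_ring m)
    (R_qfp : quasi_fiber_product_ring x)
    (M_nz : nonzero_module M) (M_fg : fin_gen M)
    (N_nz : nonzero_module N) (N_fg : fin_gen N)
    (N_rigid : Tor_rigid N) (N_mcm : maximal_CM m N)
    (t : nat) (t_gt : (n < t)%N)
    (Ext_van : forall i : nat, (t <= i <= t + n)%N -> Ext_zero i M N) :
  finite_pd M \/ free_module N.
Proof.
have [F] := minres_exists R_local M_fg; have [G] := minres_exists R_local N_fg.
case: t t_gt Ext_van => // t _ Ext_van.
have [||[k Gk]] := rigid_dichotomy R_local F G R_qfp (t := t) N_nz N_rigid.
- by move=> i; rewrite size_tuple => ti; apply: Ext_van; lia.
- by left.
by right; apply: (finite_res_MCM_free R_local Gk).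
Qed.
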